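(* Let $m,n \in \mathbb{N}$, $S = (s_1,\dots,s_n)^T \in \mathbb{N}^n$ with $s_k \le 2^m$, fix $c \in \mathbb{N}$ and let $N = n^c$. Define $U = (u_1,\dots,u_n)^T$ by $u_k = \left\lfloor N \cdot \frac{s_k}{\|S\|}\right\rfloor$, let $c_a = \frac{\sum_{k=1}^n u_k s_k}{\|U\|\cdot\|S\|}$ and $d^{\star} = \frac{\sqrt{n}}{2}\sqrt{1-c_a^2}$. There exists an algorithm of complexity $\mathcal{O}\left(N\cdot n^{5/2}\right)$ which upon completion fulfils exactly one of the following alternatives: (1) it proves that the slab $\mathcal{S}\left(S, \frac{1}{2}\cdot 1_{n\times 1}, 2\cdot d^{\star}\right)$ contains no vertex of the hypercube $Q_n = [0,1]^n$; (2) it finds a vertex of the hypercube $Q_n = [0,1]^n$ in the slab $\mathcal{S}\left(S, \frac{1}{2}\cdot 1_{n\times 1}, 8\cdot d^{\star}\right)$.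
   Context: For a hyperplane $S^T(x - C) = 0$ with $S \in \mathbb{R}^n\setminus\{0\}$, $C \in \mathbb{R}^n$, and $\delta > 0$, the slab of thickness $\delta$ of the unit hypercube $Q_n=[0,1]^n$ is $\mathcal{S}(S,C,\delta) = \left\{x \in Q_n : -\frac{\delta}{2} \le \frac{S^T}{\|S\|}(x - C) \le \frac{\delta}{2}\right\}$. $1_{n\times 1}$ is the all-ones vector, $\|\cdot\|$ the Euclidean norm. (The paper notes $2d^\star \approx n/N$ as $n/N^2 \to 0$.) *)

(* Defs.v *)
From HB Require Import structures.
From mathcomp Require Import all_boot all_order all_algebra.
From mathcomp Require Import reals Rstruct.
Set Implicit Arguments. Unset Strict Implicit. Unset Printing Implicit Defensive.
Import Order.TTheory GRing.Theory Num.Theory.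
Local Open Scope ring_scope.

Notation R := Rdefinitions.R.

Definition vnorm (n : nat) (v : 'I_n -> R) : R := Num.sqrt (\sum_(i < n) v i ^+ 2).

Definition in_slab (n : nat) (S C : 'I_n -> R) (delta : R) (x : 'I_n -> R) : Prop :=
  (forall i, 0 <= x i <= 1) /\
  - (delta / 2) <= (\sum_(i < n) S i * (x i - C i)) / vnorm S <= delta / 2.

Definition is_vertex (n : nat) (x : 'I_n -> R) : Prop :=
  forall i, x i = 0 \/ x i = 1.

Definition Svec (n : nat) (s : 'I_n -> nat) : 'I_n -> R := fun k => (s k)%:R.
Definition Nval (n c : nat) : nat := (n ^ c)%N.
Definition Uvec (n c : nat) (s : 'I_n -> nat) : 'I_n -> R :=
  fun k => (Num.floor ((Nval n c)%:R * (Svec s k / vnorm (Svec s))))%:~R.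
Definition c_a (n c : nat) (s : 'I_n -> nat) : R :=
  (\sum_(k < n) Uvec c s k * Svec s k) / (vnorm (Uvec c s) * vnorm (Svec s)).
Definition dstar (n c : nat) (s : 'I_n -> nat) : R :=
  Num.sqrt (n%:R) / 2 * Num.sqrt (1 - c_a c s ^+ 2).

Definition half_ones (n : nat) : 'I_n -> R := fun _ => 1 / 2.

(* Machine model: unit-cost random access machine (RAM)                *)

Inductive instr : Type :=
| IConst (d k : nat)
| IAdd (d a b : nat)
| ISub (d a b : nat)          (* r_d := r_a - r_b (truncated) *)
| IMul (d a b : nat)
| IDiv (d a b : nat)          (* r_d := r_a %/ r_b (0 if r_b = 0) *)
| ILoad (d a : nat)
| IStore (a b : nat)
| IJz (r l : nat)
| IJmp (l : nat)
| IHalt.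

Definition program := seq instr.
Definition regs := nat -> nat.
Definition config : Type := (nat * regs)%type.

Definition upd (rg : regs) (d v : nat) : regs := fun i => if i == d then v else rg i.

Definition step (P : program) (cf : config) : config :=
  let: (pc, rg) := cf in
  match nth IHalt P pc with
  | IConst d k => (pc.+1, upd rg d k)
  | IAdd d a b => (pc.+1, upd rg d (rg a + rg b)%N)
  | ISub d a b => (pc.+1, upd rg d (rg a - rg b)%N)
  | IMul d a b => (pc.+1, upd rg d (rg a * rg b)%N)
  | IDiv d a b => (pc.+1, upd rg d (rg a %/ rg b)%N)
  | ILoad d a => (pc.+1, upd rg d (rg (rg a)))
  | IStore a b => (pc.+1, upd rg (rg a) (rg b))
  | IJz r l => if rg r == 0%N then (l, rg) else (pc.+1, rg)
  | IJmp l => (l, rg)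
  | IHalt => (pc, rg)
  end.

Definition run (P : program) (t : nat) (cf : config) : config := iter t (step P) cf.

(* the machine has halted: the current instruction is IHalt (or pc is out of range) *)
Definition halted (P : program) (cf : config) : bool :=
  match nth IHalt P cf.1 with IHalt => true | _ => false end.

(* input encoding: r_0 = n, r_(k+1) = s_k for k < n, all other registers 0 *)
Definition input_regs (n : nat) (s : 'I_n -> nat) : regs :=
  fun i => if i == 0%N then n else odflt 0%N (omap s (insub i.-1)).

(* output convention: r_0 = 0  means alternative (1) (no vertex in the thin slab);
   r_0 = 1  means alternative (2), the found vertex being x_k = r_(k+1). *)
Definition output_vertex (n : nat) (rg : regs) : 'I_n -> R := fun k => (rg k.+1)%:R.

Definition output_correct (n c : nat) (s : 'I_n -> nat) (rg : regs) : Prop :=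
  (rg 0%N = 0%N /\
     ~ (exists x, is_vertex x /\ in_slab (Svec s) (@half_ones n) (2 * dstar c s) x)) \/
  (rg 0%N = 1%N /\ is_vertex (@output_vertex n rg) /\
     in_slab (Svec s) (@half_ones n) (8 * dstar c s) (@output_vertex n rg)).

(* Main.v *)
(* Replacing S by the integer vector U (of norm at most N) tilts the hyperplane by
   the angle whose cosine is [c_a], so with y = x - 1/2, |y|^2 = n/4, a vertex
   within [d*] of the hyperplane of S is within [2 d*] of that of U, and
   conversely the latter puts it within [sqrt 10 d* <= 4 d*] of the hyperplane
   of S.  It is therefore enough to minimise |U . y| exactly, a subset sum problem
   solved by dynamic programming in O(n * sum u_k) steps with sum u_k <= n N, and to
   test whether the minimiser lies in the thick slab; after squaring, both
   the test and the computation of u_k only involve integers. *)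

Require Import Defs.
From HB Require Import structures.
From mathcomp Require Import all_boot all_order all_algebra.
From mathcomp Require Import reals Rstruct.
From mathcomp Require Import zify ring lra.
Import Order.TTheory GRing.Theory Num.Theory.

(** * Structured programs for the machine *)

(** The constants come from one inequality used twice. With D = |a|^2 |b|^2 - (a.b)^2, a bound
    (a.y)^2 |b|^2 <= t |y|^2 D implies (b.y)^2 |a|^2 <= 2 (1 + t) |y|^2 D, and distance d*
    corresponds to t = 1. Passing from S to U turns 1 into 4; minimality, together with the common
    value of |y|^2 at all vertices, transfers the 4 to the computed vertex; passing back turns 4
    into 10, below 16, the square of the half-width 4 d* of the thick slab. The obstacle is the
    machine: one explicit program, depending on [c] only, must serve every [n] and [s]. It is
    written in a small language of assignments, array writes and counted loops, for which result and
    cost are total functions, so that running time is proved along with correctness. Only moving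
    input and output between the low registers and the arrays is coded by hand. The total is O(N
    n^2) steps. *)

Inductive scmd : Type :=
| Do (s : seq instr)
| Then (c d : scmd)
| If (r : nat) (c : scmd)
| While (r : nat) (c : scmd).

(** [p] is the address at which the code is placed, since jump targets are absolute. Every block is
    left by running off its end. *)
Fixpoint assemble (p : nat) (c : scmd) : program :=
  match c with
  | Do s => s
  | Then c d => let a := assemble p c in a ++ assemble (p + size a) d
  | If r c => let a := assemble p.+1 c in IJz r (p.+1 + size a) :: a
  | While r c =>
      let a := assemble p.+1 c in IJz r (p + size a).+2 :: rcons a (IJmp p)
  end.

Definition plain (i : instr) : bool :=
  match i with IJz _ _ | IJmp _ | IHalt => false | _ => true end.

(** Read off [step] on a one-instruction program, so that no second semantics has to be related to
    the machine. *)
Definition act (rg : regs) (i : instr) : regs := (step [:: i] (0%N, rg)).2.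

Arguments act : simpl never.

Lemma actE :
  (forall rg d k, act rg (IConst d k) = upd rg d k) *
  (forall rg d a b, act rg (IAdd d a b) = upd rg d (rg a + rg b)) *
  (forall rg d a b, act rg (ISub d a b) = upd rg d (rg a - rg b)) *
  (forall rg d a b, act rg (IMul d a b) = upd rg d (rg a * rg b)) *
  (forall rg d a b, act rg (IDiv d a b) = upd rg d (rg a %/ rg b)) *
  (forall rg d a, act rg (ILoad d a) = upd rg d (rg (rg a))) *
  (forall rg a b, act rg (IStore a b) = upd rg (rg a) (rg b)).
Proof. by []. Qed.

Inductive runs : scmd -> regs -> nat -> regs -> Prop :=
| runs_do s rg : all plain s -> runs (Do s) rg (size s) (foldl act rg s)
| runs_then c d rg t rg1 u rg2 :
    runs c rg t rg1 -> runs d rg1 u rg2 -> runs (Then c d) rg (t + u) rg2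
| runs_if_false r c rg : rg r = 0%N -> runs (If r c) rg 1 rg
| runs_if_true r c rg t rg1 :
    rg r != 0%N -> runs c rg t rg1 -> runs (If r c) rg t.+1 rg1
| runs_while_stop r c rg : rg r = 0%N -> runs (While r c) rg 1 rg
| runs_while_next r c rg t rg1 u rg2 :
    rg r != 0%N -> runs c rg t rg1 -> runs (While r c) rg1 u rg2 ->
    runs (While r c) rg (t + u).+2 rg2.

Arguments run : simpl never.

Lemma runD P t u cf : run P (t + u) cf = run P u (run P t cf).
Proof. by rewrite /run addnC iterD. Qed.

Lemma runS P t cf : run P t.+1 cf = run P t (step P cf).
Proof. by rewrite /run iterSr. Qed.

Lemma step_at pre i post rg :
  step (pre ++ i :: post) (size pre, rg) =
  match i with
  | IJz r l => if rg r == 0%N then (l, rg) else ((size pre).+1, rg)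
  | IJmp l => (l, rg)
  | IHalt => (size pre, rg)
  | _ => ((size pre).+1, act rg i)
  end.
Proof. by rewrite /step nth_cat ltnn subnn /=; case: i. Qed.

(** Arbitrary code before and after the block lets the induction hypotheses apply to sub-blocks at
    their own addresses. *)
Lemma assemble_runs c rg t rg' : runs c rg t rg' ->
  forall pre post,
  run (pre ++ assemble (size pre) c ++ post) t (size pre, rg) =
  ((size pre + size (assemble (size pre) c))%N, rg').
Proof.
elim=> {c rg t rg'}.
- move=> s rg; elim: s rg => [|i s IHs] rg /= hs pre post; first by rewrite addn0.
  case/andP: hs => hi hs; rewrite runS.
  have -> : step (pre ++ i :: s ++ post) (size pre, rg) = ((size pre).+1, act rg i).
    by rewrite step_at; case: i hi.
  have := IHs (act rg i) hs (rcons pre i) post.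
  by rewrite cat_rcons size_rcons addSnnS.
- move=> c d rg t rg1 u rg2 _ IHc _ IHd pre post /=.
  rewrite runD -catA IHc.
  have := IHd (pre ++ assemble (size pre) c) post.
  by rewrite size_cat -!catA => ->; rewrite size_cat addnA.
- move=> r c rg r0 pre post /=; rewrite runS step_at r0 eqxx /=.
  by rewrite addnS.
- move=> r c rg t rg1 r0 _ IHc pre post /=; rewrite runS step_at (negbTE r0) /=.
  have := IHc (rcons pre (IJz r (size pre + size (assemble (size pre).+1 c)).+1)) post.
  by rewrite size_rcons cat_rcons !addSn => ->; rewrite addnS.
- move=> r c rg r0 pre post /=; rewrite runS step_at r0 eqxx /=.
  by rewrite size_rcons !addnS.
- move=> r c rg t rg1 u rg2 r0 _ IHc _ IHw pre post /=.
  (* Of the two steps beyond body and remaining loop, the first is the test, consumed here; the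
     second is the jump back. *)
  rewrite runS step_at (negbTE r0) -[(t + u).+1]addnS runD.
  set j := IJz _ _.
  have := IHc (rcons pre j) (IJmp (size pre) :: post).
  rewrite size_rcons cat_rcons -cats1 -!catA /= => ->.
  rewrite runS.
  have -> : pre ++ j :: assemble (size pre).+1 c ++ IJmp (size pre) :: post =
    (pre ++ j :: assemble (size pre).+1 c) ++ IJmp (size pre) :: post.
    by rewrite -!catA.
  have -> : ((size pre).+1 + size (assemble (size pre).+1 c))%N =
    size (pre ++ j :: assemble (size pre).+1 c).
    by rewrite size_cat /= addSnnS.
  rewrite step_at -!catA /=.
  have := IHw pre post.
  by rewrite /= -/j -cats1 -!catA.
Qed.

Lemma run_assemble c rg t rg' : runs c rg t rg' ->
  run (assemble 0 c) t (0, rg) = (size (assemble 0 c), rg').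
Proof.
by move=> h; have := assemble_runs _ _ _ _ h [::] [::]; rewrite cats0 => ->.
Qed.

Lemma halted_end P rg : halted P (size P, rg).
Proof. by rewrite /halted nth_default. Qed.

(** [m] counts the iterations left, and reaching 0 forces the exit. This serves the hand-written
    loops that move input and output. *)
Lemma runs_while r c b (Inv : nat -> regs -> Prop) :
  (forall rg, Inv 0%N rg -> rg r = 0%N) ->
  (forall m rg, Inv m.+1 rg -> rg r != 0%N /\
     exists t rg', (t <= b)%N /\ runs c rg t rg' /\ Inv m rg') ->
  forall m rg, Inv m rg ->
  exists t rg', (t <= m * b.+2 + 1)%N /\ runs (While r c) rg t rg' /\ Inv 0%N rg'.
Proof.
move=> h0 hS; elim=> [|m IHm] rg hI.
  by exists 1%N, rg; split=> //; split=> //; apply: runs_while_stop; apply: h0.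
have [r0 [t [rg1 [tb [hc hI1]]]]] := hS _ _ hI.
have [u [rg2 [ub [hw hI2]]]] := IHm _ hI1.
exists (t + u).+2, rg2; split; first by lia.
by split=> //; apply: runs_while_next hw.
Qed.

(** * A language with arrays and counted loops, and its compiler *)

(* Registers below 32 hold variables, registers 32 to 63 temporaries; the cell
   [j] of array [a < 8] lives in register [64 + 8 j + a], so that the arrays are
   unbounded and pairwise disjoint. *)

Inductive binop : Type := OAdd | OSub | OMul | ODiv.

Inductive expr : Type :=
| Cst (k : nat)
| Var (x : nat)
| Bin (o : binop) (e f : expr)
| Arr (a : nat) (e : expr).

(** There is no conditional: truncated subtraction turns comparisons into 0/1 factors. A loop
    evaluates its bound once, on entry, so every command terminates. *)
Inductive cmd : Type :=
| Asg (x : nat) (e : expr)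
| Put (a : nat) (e f : expr)
| Seq (c d : cmd)
| For (x : nat) (e : expr) (c : cmd).

Definition store : Type := ((nat -> nat) * (nat -> nat -> nat))%type.

Definition setv (st : store) (x v : nat) : store := (upd st.1 x v, st.2).
Definition seta (st : store) (a j v : nat) : store :=
  (st.1, fun b => if b == a then upd (st.2 a) j v else st.2 b).

Definition binop_nat (o : binop) : nat -> nat -> nat :=
  match o with OAdd => addn | OSub => subn | OMul => muln | ODiv => divn end.

Fixpoint eval (e : expr) (st : store) : nat :=
  match e with
  | Cst k => k
  | Var x => st.1 x
  | Bin o e f => binop_nat o (eval e st) (eval f st)
  | Arr a e => st.2 a (eval e st)
  end.

Fixpoint sem (c : cmd) (st : store) : store :=
  match c with
  | Asg x e => setv st x (eval e st)
  | Put a e f => seta st a (eval e st) (eval f st)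
  | Seq c d => sem d (sem c st)
  | For x e c => iteri (eval e st) (fun i st' => sem c (setv st' x i)) st
  end.

Definition cell (a j : nat) : nat := (64 + 8 * j + a)%N.

Definition binop_instr (o : binop) : nat -> nat -> nat -> instr :=
  match o with OAdd => IAdd | OSub => ISub | OMul => IMul | ODiv => IDiv end.

Definition to_cell (t u a : nat) : seq instr :=
  [:: IConst u 8; IMul t t u; IConst u (64 + a); IAdd t t u].

(** [t] acts as a stack pointer: the value is left in [t], and pending operands sit below it. Adding
    to zero replaces a move instruction. *)
Fixpoint cexpr (t : nat) (e : expr) : seq instr :=
  match e with
  | Cst k => [:: IConst t k]
  | Var x => [:: IConst t 0; IAdd t t x]
  | Bin o e f => cexpr t e ++ cexpr t.+1 f ++ [:: binop_instr o t t t.+1]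
  | Arr a e => cexpr t e ++ to_cell t t.+1 a ++ [:: ILoad t t]
  end.

(** A loop keeps its remaining iterations in [t] and its index in [t.+1], out of reach of the body,
    which may therefore overwrite [x]. *)
Fixpoint ccmd (t : nat) (c : cmd) : scmd :=
  match c with
  | Asg x e => Do (cexpr t e ++ [:: IConst x 0; IAdd x x t])
  | Put a e f =>
      Do (cexpr t e ++ cexpr t.+1 f ++ to_cell t t.+2 a ++ [:: IStore t t.+1])
  | Seq c d => Then (ccmd t c) (ccmd t d)
  | For x e c =>
      Then (Do (cexpr t e ++ [:: IConst t.+1 0]))
           (While t (Then (Do [:: IConst x 0; IAdd x x t.+1])
              (Then (ccmd t.+2 c)
                 (Do [:: IConst t.+2 1; IAdd t.+1 t.+1 t.+2; ISub t t t.+2]))))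
  end.

Fixpoint esize (e : expr) : nat :=
  match e with
  | Cst _ => 1
  | Var _ => 2
  | Bin _ e f => (esize e + esize f).+1
  | Arr _ e => esize e + 5
  end.

(** The 7 per iteration is 2 to copy the index, 3 to update the counters, and 2 for the test and the
    jump back; the 2 outside is the index initialisation and the failing test. *)
Fixpoint cost (c : cmd) (st : store) : nat :=
  match c with
  | Asg x e => esize e + 2
  | Put a e f => esize e + esize f + 5
  | Seq c d => cost c st + cost d (sem c st)
  | For x e c =>
      (esize e + 2 + \sum_(i < eval e st)
        (cost c (setv (iteri i (fun i st' => sem c (setv st' x i)) st) x i) + 7))%N
  end.

Fixpoint ewf (t : nat) (e : expr) : bool :=
  match e with
  | Cst _ => t < 64
  | Var x => (t < 64) && (x < 32)
  | Bin _ e f => ewf t e && ewf t.+1 f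
  | Arr a e => [&& ewf t e, t.+1 < 64 & a < 8]
  end.

Fixpoint cwf (t : nat) (c : cmd) : bool :=
  match c with
  | Asg x e => ewf t e && (x < 32)
  | Put a e f => [&& ewf t e, ewf t.+1 f, t.+2 < 64 & a < 8]
  | Seq c d => cwf t c && cwf t d
  | For x e c => [&& ewf t e, t.+2 < 64, x < 32 & cwf t.+2 c]
  end.

Definition simulates (rg : regs) (st : store) : Prop :=
  (forall x, (x < 32)%N -> rg x = st.1 x) /\
  (forall a j, (a < 8)%N -> rg (cell a j) = st.2 a j).

Lemma size_cexpr t e : size (cexpr t e) = esize e.
Proof.
elim: e t => //= [o e IHe f IHf|a e IHe] t; rewrite !size_cat /= ?IHe ?IHf //=.
by rewrite addn1 addnS.
Qed.

Lemma plain_cexpr t e : all plain (cexpr t e).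
Proof.
by elim: e t => //= [[] e IHe f IHf|a e IHe] t; rewrite !all_cat ?IHe ?IHf.
Qed.

Lemma upd_eq rg d v : upd rg d v d = v.
Proof. by rewrite /upd eqxx. Qed.

Lemma upd_neq rg d v i : i <> d -> upd rg d v i = rg i.
Proof. by rewrite /upd; case: eqP. Qed.

Lemma act_binop rg o d a b :
  act rg (binop_instr o d a b) = upd rg d (binop_nat o (rg a) (rg b)).
Proof. by case: o. Qed.

Lemma to_cellP t u a rg : (t != u)%N ->
  let rg' := foldl act rg (to_cell t u a) in
  rg' t = cell a (rg t) /\ (forall i, i != t -> i != u -> rg' i = rg i).
Proof.
move=> tu /=; have ut := negbTE tu; rewrite eq_sym in ut.
rewrite /= !actE /upd !(eqxx, ut, negbTE tu).
split; first by rewrite /cell; lia.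
by move=> i /negbTE -> /negbTE ->.
Qed.

Lemma ewf_bound t e : ewf t e -> (t < 64)%N.
Proof.
by elim: e t => //= [x u /andP[]|? g IHg h _ u /andP[/IHg]|a g IHg u /and3P[/IHg]].
Qed.

(** Registers below [t] hold variables and pending operands, those from 64 on hold arrays;
    preserving both keeps the simulation alive between subexpressions. *)
Lemma cexprP e st t rg : (32 <= t)%N -> ewf t e -> simulates rg st ->
  let rg' := foldl act rg (cexpr t e) in
  [/\ rg' t = eval e st, forall i, (i < t)%N -> rg' i = rg i &
      forall i, (64 <= i)%N -> rg' i = rg i].
Proof.
elim: e t rg => /=.
- move=> k t rg t32 wf sim; rewrite /= !actE upd_eq; split=> // i hi; rewrite upd_neq //; lia.
- move=> x t rg t32 /andP [wf x32] sim; rewrite /= !actE upd_eq; split.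
  + by rewrite upd_eq upd_neq ?sim.1 //; lia.
  + by move=> i hi; rewrite !upd_neq //; lia.
  + by move=> i hi; rewrite !upd_neq //; lia.
- move=> o e IHe f IHf t rg t32 /andP [we wf] sim; rewrite !foldl_cat.
  have [v1 lo1 hi1] := IHe _ _ t32 we sim.
  set rg1 := foldl act rg _ in v1 lo1 hi1 *.
  have sim1 : simulates rg1 st.
    split=> [x hx|a j ha]; first by rewrite lo1 ?sim.1 //; lia.
    by rewrite hi1 ?sim.2 // /cell; lia.
  have [v2 lo2 hi2] := IHf _ _ (leqW t32) wf sim1.
  set rg2 := foldl act rg1 _ in v2 lo2 hi2 *.
  have tb := ewf_bound _ _ wf.
  rewrite [foldl _ _ _]/= act_binop upd_eq; split.
  + by rewrite lo2 // v1 v2.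
  + by move=> i hi; rewrite upd_neq ?lo2 ?lo1 //; lia.
  + by move=> i hi; rewrite upd_neq ?hi2 ?hi1 //; lia.
- move=> a e IHe t rg t32 /and3P [we tb ha] sim.
  rewrite -[_ :: _]/(to_cell t t.+1 a ++ [:: ILoad t t]) !foldl_cat.
  have [v1 lo1 hi1] := IHe _ _ t32 we sim.
  set rg1 := foldl act rg _ in v1 lo1 hi1 *.
  have sim1 : simulates rg1 st.
    split=> [x hx|b j hb]; first by rewrite lo1 ?sim.1 //; lia.
    by rewrite hi1 ?sim.2 // /cell; lia.
  have [|v2 fr2] := @to_cellP t t.+1 a rg1; first by lia.
  set rg2 := foldl act rg1 _ in v2 fr2 *.
  rewrite -[foldl act rg2 _]/(upd rg2 t (rg2 (rg2 t))) upd_eq; split.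
  + rewrite v2 fr2 ?sim1.2 ?v1 //; rewrite /cell; lia.
  + by move=> i hi; rewrite upd_neq ?fr2 ?lo1 //; lia.
  + by move=> i hi; rewrite upd_neq ?fr2 ?hi1 //; lia.
Qed.

(** The clause on registers 32 to [t] - 1 is what protects the counters of enclosing loops, about
    which [simulates] says nothing. *)
Lemma ccmdP c t st rg : (32 <= t)%N -> cwf t c -> simulates rg st ->
  exists u rg', [/\ (u <= cost c st)%N, runs (ccmd t c) rg u rg',
    simulates rg' (sem c st) & forall i, (32 <= i < t)%N -> rg' i = rg i].
Proof.
elim: c t st rg => /=.
- move=> x e t st rg t32 /andP [we hx] sim.
  set s := _ ++ _.
  exists (size s), (foldl act rg s); split.
  + by rewrite size_cat size_cexpr.
  + by apply: runs_do; rewrite all_cat plain_cexpr.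
  + have [v lo hi] := cexprP _ _ _ _ t32 we sim.
    rewrite foldl_cat /= !actE.
    split=> [y hy|a j ha] /=.
      have [->|yx] := eqVneq y x.
        by rewrite !upd_eq upd_neq ?v //; lia.
      by rewrite !upd_neq ?lo ?sim.1 //; try exact/eqP; lia.
    by rewrite !upd_neq ?hi ?sim.2 // /cell; lia.
  + have [v lo hi] := cexprP _ _ _ _ t32 we sim.
    move=> i hi'; rewrite foldl_cat /= !actE !upd_neq ?lo //; lia.
- move=> a e f t st rg t32 /and4P [we wf tb ha] sim.
  set s := cexpr t e ++ cexpr t.+1 f ++ to_cell t t.+2 a ++ [:: IStore t t.+1].
  exists (size s), (foldl act rg s).
  have [v1 lo1 hi1] := cexprP _ _ _ _ t32 we sim.
  set rg1 := foldl act rg (cexpr t e) in v1 lo1 hi1.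
  have sim1 : simulates rg1 st.
    split=> [x hx|b j hb]; first by rewrite lo1 ?sim.1 //; lia.
    by rewrite hi1 ?sim.2 // /cell; lia.
  have [v2 lo2 hi2] := cexprP _ _ _ _ (leqW t32) wf sim1.
  set rg2 := foldl act rg1 (cexpr t.+1 f) in v2 lo2 hi2.
  have [|v3 fr3] := @to_cellP t t.+2 a rg2; first by lia.
  set rg3 := foldl act rg2 _ in v3 fr3.
  have e3 : foldl act rg s = upd rg3 (cell a (eval e st)) (eval f st).
    rewrite /s !foldl_cat -/rg1 -/rg2 -/rg3.
    rewrite -[LHS]/(upd rg3 (rg3 t) (rg3 t.+1)) v3 fr3 ?v2 ?lo2 ?v1 //; lia.
  rewrite e3; split.
  + by rewrite !size_cat !size_cexpr /= addnA.
  + by rewrite -e3; apply: runs_do; rewrite !all_cat !plain_cexpr.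
  + split=> [y hy|b j hb] /=.
      by rewrite upd_neq ?fr3 ?lo2 ?lo1 ?sim.1 // /cell; lia.
    have [->|ba] := eqVneq b a.
      have [->|je] := eqVneq j (eval e st); first by rewrite !upd_eq.
      rewrite !upd_neq /cell; try by move/eqP: je; lia.
      by rewrite fr3 ?hi2 ?hi1 -/(cell a j) ?sim.2 // /cell; lia.
    rewrite !upd_neq /cell; last by move/eqP: ba; lia.
    by rewrite fr3 ?hi2 ?hi1 -/(cell b j) ?sim.2 // /cell; lia.
  + move=> i hi; rewrite upd_neq ?fr3 ?lo2 ?lo1 // /cell; lia.
- move=> c IHc d IHd t st rg t32 /andP [wc wd] sim.
  have [u [rg1 [ub hc sim1 fr1]]] := IHc _ _ _ t32 wc sim.
  have [v [rg2 [vb hd sim2 fr2]]] := IHd _ _ _ t32 wd sim1.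
  exists (u + v)%N, rg2; split=> //.
  + exact: leq_add.
  + exact: runs_then hd.
  + by move=> i hi; rewrite fr2 ?fr1.
- move=> x e c IHc t st rg t32 /and4P [we tb hx wc] sim.
  set n := eval e st.
  pose F := fun i st' => sem c (setv st' x i).
  have [v0 lo0 hi0] := cexprP _ _ _ _ t32 we sim.
  set s := cexpr t e ++ _.
  set w := While t _.
  suff [v [rg2 [vb hw sim2 fr2]]] : exists v rg2,
     [/\ (v <= 1 + \sum_(i < n) (cost c (setv (iteri i F st) x i) + 7))%N,
         runs w (foldl act rg s) v rg2, simulates rg2 (iteri n F st) &
         forall i, (32 <= i < t)%N -> rg2 i = rg i].
    exists (size s + v)%N, rg2; split=> //.
      apply: leq_trans (leq_add (leqnn _) vb) _.
      by rewrite size_cat size_cexpr addnA -[(_ + 1 + 1)%N]addnA.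
    apply: runs_then hw; apply: runs_do.
    by rewrite all_cat plain_cexpr.
  pose Inv j rg' := [/\ simulates rg' (iteri j F st),
    forall i, (32 <= i < t)%N -> rg' i = rg i, rg' t = (n - j)%N & rg' t.+1 = j].
  have I0 : Inv 0%N (foldl act rg s).
    rewrite foldl_cat /= !actE; split.
    + split=> [y hy|a j ha] /=.
        by rewrite upd_neq ?lo0 ?sim.1 //; lia.
      by rewrite upd_neq ?hi0 ?sim.2 // /cell; lia.
    + by move=> i hi; rewrite upd_neq ?lo0 //; lia.
    + by rewrite upd_neq ?v0 ?subn0 //; lia.
    + by rewrite upd_eq.
  have step j rg' : (j < n)%N -> Inv j rg' -> exists v rg2,
     [/\ (v <= cost c (setv (iteri j F st) x j) + 5)%N, Inv j.+1 rg2 & forall u rg3,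
        runs w rg2 u rg3 -> runs w rg' (v + u).+2 rg3].
    move=> jn [simj frj tj idxj].
    set s1 := [:: IConst x 0; IAdd x x t.+1].
    have lo1 i : i <> x -> foldl act rg' s1 i = rg' i.
      by move=> ix; rewrite /s1 /= !actE !upd_neq.
    have sim1 : simulates (foldl act rg' s1) (setv (iteri j F st) x j).
      rewrite /s1 /= !actE; split=> [y hy|a k ha] /=.
        have [->|yx] := eqVneq y x.
          by rewrite !upd_eq upd_neq ?idxj //; lia.
        by rewrite !upd_neq ?simj.1 //; exact/eqP.
      by rewrite !upd_neq ?simj.2 // /cell; lia.
    have [v [rg1 [vb hc sim2 fr]]] := IHc t.+2 _ _ (leqW (leqW t32)) wc sim1.
    set s2 := [:: IConst t.+2 1; IAdd t.+1 t.+1 t.+2; ISub t t t.+2].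
    exists (2 + (v + 3))%N, (foldl act rg1 s2); split.
    + by lia.
    + have t1 : rg1 t = (n - j)%N by rewrite fr ?lo1 ?tj //; lia.
      have i1 : rg1 t.+1 = j by rewrite fr ?lo1 ?idxj //; lia.
      rewrite /s2 /= !actE; split.
      * split=> [y hy|a k ha] /=; first by rewrite !upd_neq ?sim2.1 //; lia.
        by rewrite !upd_neq ?sim2.2 // /cell; lia.
      * by move=> i hi; rewrite !upd_neq ?fr ?lo1 ?frj //; lia.
      * rewrite upd_eq /upd !eqxx.
        do ![case: eqP => ?; try lia].
      * rewrite /upd !eqxx.
        do ![case: eqP => ?; try lia].
    + move=> u rg3 hw; apply: (runs_while_next _ _ _ _ _ _ _ _ _ hw).
        by rewrite tj; lia.
      apply: runs_then; first exact: (runs_do s1).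
      by apply: runs_then; first exact: hc; exact: (runs_do s2).
  have main k j rg' : (j + k)%N = n -> Inv j rg' -> exists v rg2,
     [/\ (v <= 1 + \sum_(j <= i < n) (cost c (setv (iteri i F st) x i) + 7))%N,
         runs w rg' v rg2 & Inv n rg2].
    elim: k j rg' => [|k IHk] j rg' ejn hI.
      have ej : j = n by lia.
      subst j; exists 1%N, rg'; split=> //.
      by apply: runs_while_stop; case: hI => _ _ ->; lia.
    have jn : (j < n)%N by lia.
    have [v [rg2 [vb hI2 hw]]] := step _ _ jn hI.
    have [|u [rg3 [ub hr hI3]]] := IHk _ _ _ hI2; first by lia.
    exists (v + u).+2, rg3; split=> //; last exact: hw.
    rewrite big_ltn //; lia.
  have [v [rg2 [vb hr [sim2 fr2 _ _]]]] := main n 0%N _ (add0n n) I0.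
  by exists v, rg2; split=> //; move: vb; rewrite big_mkord.
Qed.

(** * Bounding cost and result of high-level commands *)

(** Being syntactic, this computes on concrete programs, so that frame conditions are discharged by
    [isT]. *)
Fixpoint modv (c : cmd) (x : nat) : bool :=
  match c with
  | Asg y _ => x == y
  | Put _ _ _ => false
  | Seq c d => modv c x || modv d x
  | For y _ c => (x == y) || modv c x
  end.

Fixpoint moda (c : cmd) (a : nat) : bool :=
  match c with
  | Asg _ _ => false
  | Put b _ _ => a == b
  | Seq c d => moda c a || moda d a
  | For _ _ c => moda c a
  end.

Definition frame (c : cmd) (st st' : store) : Prop :=
  (forall x, ~~ modv c x -> st'.1 x = st.1 x) /\
  (forall a, ~~ moda c a -> forall j, st'.2 a j = st.2 a j).

Lemma iteri_ind (T : Type) (P : nat -> T -> Prop) (f : nat -> T -> T) n x :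
  P 0 x -> (forall i y, i < n -> P i y -> P i.+1 (f i y)) -> P n (iteri n f x).
Proof.
move=> h0 hS; elim: n hS => //= n IHn hS; apply: (hS) => //.
by apply: IHn => i y hi; apply: hS; apply: ltnW.
Qed.

Lemma frame_trans c st1 st2 st3 :
  frame c st1 st2 -> frame c st2 st3 -> frame c st1 st3.
Proof.
move=> [v1 a1] [v2 a2]; split=> [x hx|a ha j]; first by rewrite v2 ?v1.
by rewrite a2 ?a1.
Qed.

Lemma frame_sub c d st st' :
  (forall x, modv c x -> modv d x) -> (forall a, moda c a -> moda d a) ->
  frame c st st' -> frame d st st'.
Proof.
move=> hv ha [fv fa]; split=> [x hx|a hx j].
  by apply: fv; apply: contraNN hx; apply: hv.
by apply: fa; apply: contraNN hx; apply: ha.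
Qed.

Lemma frame_sem c st : frame c st (sem c st).
Proof.
elim: c st => /= [x e|a e f|c IHc d IHd|x e c IHc] st.
- by split=> //= y /negbTE xy; rewrite /upd xy.
- by split=> //= b /negbTE ab j; rewrite /= ab.
- apply: (@frame_trans _ _ (sem c st)).
    by apply: frame_sub (IHc st) => y /= ->.
  by apply: frame_sub (IHd _) => y /= ->; rewrite orbT.
- apply: (@iteri_ind _ (fun _ => frame (For x e c) st)) => // i st' _ h.
  apply: frame_trans h _.
  have [v a] := IHc (setv st' x i); split=> [y /= /norP [/negbTE xy my]|b mb j].
    by rewrite v //= /upd xy.
  by rewrite a.
Qed.

Definition wp (c : cmd) (b : nat) (Q : store -> Prop) (st : store) : Prop :=
  cost c st <= b /\ Q (sem c st).

Lemma wp_weaken c b b' (Q Q' : store -> Prop) st :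
  wp c b Q st -> b <= b' -> (forall st', Q st' -> Q' st') -> wp c b' Q' st.
Proof. by move=> [hc hQ] bb' QQ'; split; [apply: leq_trans bb' | apply: QQ']. Qed.

Lemma wp_frame c b Q st :
  wp c b Q st -> wp c b (fun st' => Q st' /\ frame c st st') st.
Proof. by move=> [hc hQ]; split=> //; split=> //; apply: frame_sem. Qed.

Lemma wp_asg x e Q st :
  Q (setv st x (eval e st)) -> wp (Asg x e) (esize e + 2) Q st.
Proof. by split. Qed.

Lemma wp_seq c d b b' Q st :
  wp c b (wp d b' Q) st -> wp (Seq c d) (b + b') Q st.
Proof. by move=> [hc [hd hQ]]; split=> //=; apply: leq_add. Qed.

Lemma wp_then c d b b' (P Q : store -> Prop) st :
  wp c b P st -> (forall st', P st' -> frame c st st' -> wp d b' Q st') ->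
  wp (Seq c d) (b + b') Q st.
Proof.
move=> hc hd; apply: wp_seq; apply: (wp_weaken _ _ _ _ _ _ (wp_frame _ _ _ _ hc) (leqnn b)).
by move=> st' [hP hf]; apply: hd.
Qed.

(** The body receives the frame relative to the state at loop entry, so an invariant need only
    mention what the loop changes. *)
Lemma wp_for x e c b st (Inv : nat -> store -> Prop) :
  Inv 0 st ->
  (forall i st', i < eval e st -> frame (For x e c) st st' -> Inv i st' ->
     wp c b (Inv i.+1) (setv st' x i)) ->
  wp (For x e c) (esize e + 2 + eval e st * (b + 7)) (Inv (eval e st)) st.
Proof.
move=> h0 hS.
pose F := fun i st' => sem c (setv st' x i).
have inv i : i <= eval e st -> Inv i (iteri i F st) /\ frame (For x e c) st (iteri i F st).
  move=> hi; apply: (@iteri_ind _ (fun i st' => Inv i st' /\ frame (For x e c) st st')).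
    by split.
  move=> j st' ji [hI hf].
  have [_ hI'] := hS j st' (leq_trans ji hi) hf hI; split=> //.
  apply: frame_trans hf _.
  have [v a] := frame_sem c (setv st' x j).
  split=> [y /= /norP [/negbTE xy my]|b' mb k]; last by rewrite a.
  by rewrite v //= /upd xy.
split; last by case: (inv _ (leqnn _)).
rewrite /= leq_add2l -[X in _ <= X * _]card_ord -sum_nat_const leq_sum // => i _.
rewrite leq_add2r.
have [hI hf] := inv i (ltnW (ltn_ord i)).
by have [] := hS _ _ (ltn_ord i) hf hI.
Qed.

(* The subset sum algorithm as a program *)
Declare Scope prog_scope.
Delimit Scope prog_scope with prog.
Bind Scope prog_scope with expr cmd.
Arguments Asg x%_nat e%_prog.
Arguments Put a%_nat e%_prog f%_prog.
Arguments For x%_nat e%_prog c%_prog.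
Arguments Seq c%_prog d%_prog.
Arguments Arr a%_nat e%_prog.
Arguments Var x%_nat.
Arguments Cst k%_nat.
Arguments Bin o e%_prog f%_prog.

Local Notation "$ x" := (Var x) (at level 1, format "$ x") : prog_scope.
Local Notation "# k" := (Cst k) (at level 1, format "# k") : prog_scope.
Local Notation "e + f" := (Bin OAdd e f) : prog_scope.
Local Notation "e - f" := (Bin OSub e f) : prog_scope.
Local Notation "e * f" := (Bin OMul e f) : prog_scope.
Local Notation "e / f" := (Bin ODiv e f) : prog_scope.
Local Notation "x ::= e" := (Asg x e) (at level 70) : prog_scope.
Local Notation "c ;; d" := (Seq c d) (at level 80, right associativity) : prog_scope.

(* Variable 0 is the register that holds [n] on input; 1 to 4 are left to the
   scratch registers of the final output phase. *)
Local Notation vn := 0 (only parsing).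
Local Notation vflag := 5 (only parsing).
Local Notation vN := 6 (only parsing).
Local Notation vQ := 7 (only parsing).
Local Notation vT := 8 (only parsing).
Local Notation vW := 9 (only parsing).
Local Notation vbest := 10 (only parsing).
Local Notation vrest := 11 (only parsing).
Local Notation vk := 12 (only parsing).
Local Notation vj := 13 (only parsing).
Local Notation vu := 14 (only parsing).
Local Notation vSX := 15 (only parsing).
Local Notation vSS := 16 (only parsing).
Local Notation vC := 17 (only parsing).
Local Notation vUU := 18 (only parsing).
Local Notation vE := 19 (only parsing).
Local Notation aS := 0 (only parsing).
Local Notation aU := 1 (only parsing).
Local Notation aD := 2 (only parsing).
Local Notation aX := 3 (only parsing).

Definition power_prog (c : nat) : cmd :=
  (vN ::= #1 ;; For vk #c (vN ::= $vN * $vn))%prog.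

Definition sum_prog (x : nat) (e : expr) : cmd :=
  (x ::= #0 ;; For vk $vn (x ::= $x + e))%prog.

(** Square roots are avoided: [u_k] is the number of j in 1..N with j^2 |S|^2 <= N^2 s_k^2, where
    [vQ] holds |S|^2. *)
Definition round_prog : cmd :=
  For vk $vn
    (vu ::= #0 ;;
     For vj $vN
       (vu ::= $vu + (#1 - (($vj + #1) * ($vj + #1) * $vQ
                             - $vN * $vN * (Arr aS $vk * Arr aS $vk)))) ;;
     Put aU $vk $vu).

(* Entry [k W + v] of [aD] counts the subsets of the first [k] weights with sum
   [v]; [#1 - (a - b)] tests [a <= b] because subtraction is truncated. *)
Definition table_prog : cmd :=
  (For vj $vW (Put aD $vj (#1 - $vj)) ;;
   For vk $vn
     (For vj $vW
       (Put aD (($vk + #1) * $vW + $vj)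
          (Arr aD ($vk * $vW + $vj)
           + (#1 - (Arr aU $vk - $vj))
             * Arr aD ($vk * $vW + ($vj - Arr aU $vk))))))%prog.

(** Complementing a vertex sends a subset sum v to T - v, so |2 v - T| is smallest at the largest
    attainable v <= T / 2. The update weighs the old and the new value by complementary 0/1
    factors. *)
Definition best_prog : cmd :=
  (vbest ::= #0 ;;
   For vj ($vT / #2 + #1)
     (vbest ::= $vbest * (#1 - Arr aD ($vn * $vW + $vj))
                + $vj * (#1 - (#1 - Arr aD ($vn * $vW + $vj)))))%prog.

(** Backtracking from the last weight: a coordinate is set to 1 only if the earlier weights cannot
    reach the remaining sum without it. *)
Definition vertex_prog : cmd :=
  (vrest ::= $vbest ;;
   For vk $vn
     (vj ::= $vn - #1 - $vk ;;
      Put aX $vj (#1 - Arr aD ($vj * $vW + $vrest)) ;;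
      vrest ::= $vrest - Arr aX $vj * Arr aU $vj))%prog.

(** [cell 3 0] is register 67, which the output itself overwrites once [n] is large, while registers
    1 to 4 must be filled last; hence a spare copy of their values. *)
Definition copy_prog : cmd :=
  (For vk #4 (Put aX ($vn + $vk) (Arr aX $vk)))%prog.

(** [vE] is 2 |S.y|, as a sum of two truncated differences one of which vanishes. The test is |S.y|
    / |S| <= 4 d*, squared and multiplied by 4 |S|^2 |U|^2. *)
Definition test_prog : cmd :=
  (vE ::= (#2 * $vSX - $vSS) + ($vSS - #2 * $vSX) ;;
   vflag ::= #1 - ($vE * $vE * $vUU
                   - #16 * $vn * ($vUU * $vQ - $vC * $vC)))%prog.

Definition main_prog (c : nat) : cmd :=
  (power_prog c ;;
   sum_prog vQ (Arr aS $vk * Arr aS $vk) ;;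
   round_prog ;;
   sum_prog vT (Arr aU $vk) ;;
   vW ::= $vT + #1 ;;
   table_prog ;;
   best_prog ;;
   vertex_prog ;;
   sum_prog vSX (Arr aS $vk * Arr aX $vk) ;;
   sum_prog vSS (Arr aS $vk) ;;
   sum_prog vC (Arr aU $vk * Arr aS $vk) ;;
   sum_prog vUU (Arr aU $vk * Arr aU $vk) ;;
   test_prog ;;
   copy_prog)%prog.

Lemma cwf_main c : cwf 32 (main_prog c).
Proof. by []. Qed.

(** * Cost and correctness of each phase *)

Lemma wp_power c n st : st.1 vn = n ->
  wp (power_prog c) (6 + c * 20) (fun st' => st'.1 vN = n ^ c) st.
Proof.
move=> hn; subst n.
apply: wp_weaken; first apply: wp_seq.
- apply: wp_asg; apply: (@wp_for _ _ _ 10 _ (fun i st' => st'.1 vN = st.1 vn ^ i)).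
    by rewrite expn0.
  move=> i st' _ [fr _] IH; split=> //=.
  by rewrite /upd /= (fr vn isT) IH expnSr.
- rewrite /=; lia.
- by [].
Qed.

Lemma wp_sum x e f n st : x != vk -> x != vn -> st.1 vn = n ->
  (forall i st', i < n -> frame (sum_prog x e) st st' ->
     eval e (setv st' vk i) = f i) ->
  wp (sum_prog x e) (7 + n * (esize e + 12))
    (fun st' => st'.1 x = \sum_(i < n) f i) st.
Proof.
move=> xk xn hn hf; subst n; apply: wp_weaken; first apply: wp_seq.
- apply: wp_asg.
  apply: (@wp_for _ _ _ (esize e + 5) _
    (fun i st' => st'.1 x = \sum_(j < i) f j)).
    by rewrite big_ord0 /= upd_eq.
  move=> i st' hi fr IH; split=> /=; first by lia.
  rewrite upd_eq big_ord_recr /= -IH upd_neq; last exact/eqP.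
  congr (_ + _); apply: hf => //.
    by move: hi; rewrite /= upd_neq //; apply/eqP; rewrite eq_sym.
  have [v a] := fr; split=> [y|//] /=.
  case: (y =P x) => //= yx h; rewrite v /= ?upd_neq //.
  by move/eqP/negbTE: yx => ->.
- by rewrite /= upd_neq; [lia | apply/eqP; rewrite eq_sym].
- by move=> st' /=; rewrite upd_neq //; apply/eqP; rewrite eq_sym.
Qed.

(* The number of [j] in [1..N] with [j <= N * s / sqrt Q]. *)
Definition rounded (N Q s : nat) : nat :=
  \sum_(j < N) (j.+1 * j.+1 * Q <= N * N * (s * s)).

Lemma rounded_le N Q s : rounded N Q s <= N.
Proof.
rewrite /rounded -[X in _ <= X]card_ord -sum1_card leq_sum // => i _; exact: leq_b1.
Qed.

Lemma wp_round n N Q s st :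
  st.1 vn = n -> st.1 vN = N -> st.1 vQ = Q -> (forall k, k < n -> st.2 aS k = s k) ->
  wp round_prog (4 + n * (29 + N * 60))
    (fun st' => forall k, k < n -> st'.2 aU k = rounded N Q (s k)) st.
Proof.
move=> hn hN hQ hs; subst N Q; set N := st.1 vN; set Q := st.1 vQ.
apply: wp_weaken.
- apply: (@wp_for _ _ _ (22 + N * 60) _
    (fun i st' => forall k, k < i -> st'.2 aU k = rounded N Q (s k))) => //=.
  rewrite hn => i st' hi fr IH.
  have [frv fra] := fr.
  have -> : 22 + N * 60 = 3 + (4 + N * 60 + 15) by lia.
  apply: wp_seq; apply: wp_asg; apply: wp_seq.
  set st1 := setv _ _ _.
  have vN1 : st1.1 vN = N by rewrite /st1 /= /upd /= (frv vN isT).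
  apply: wp_weaken; first apply: wp_frame.
  + apply: (@wp_for _ _ _ 53 _ (fun j st' => st'.1 vu =
      \sum_(j' < j) (j'.+1 * j'.+1 * Q <= N * N * (s i * s i)))).
      by rewrite big_ord0.
    move=> j st2 hj [frv2 fra2] IH2; split=> //=.
    rewrite big_ord_recr /= -IH2 /upd /= (frv2 vN isT) (frv2 vQ isT) (frv2 vk isT) fra2 //.
    rewrite /st1 /= /upd /= (frv vN isT) (frv vQ isT) fra //.
    rewrite hs // addn1 -/N -/Q; congr (_ + _).
    by case: leqP; lia.
  + by rewrite [eval _ _]vN1 /=; lia.
  + rewrite [eval _ _]vN1 => st2 /= [hu [frv2 fra2]]; split=> //= k hk.
    rewrite (frv2 vk isT) /st1 /= /upd /=.
    case: eqP => [->|ki]; first by rewrite hu.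
    by rewrite fra2 //= IH //; lia.
- by rewrite /= hn; lia.
- by rewrite /= hn.
Qed.

Fixpoint subsets (u : nat -> nat) (k v : nat) : nat :=
  if k is k'.+1 then subsets u k' v + (u k' <= v) * subsets u k' (v - u k')
  else v == 0.

Lemma subsets_sum u k (x : nat -> bool) :
  0 < subsets u k (\sum_(j < k) x j * u j).
Proof.
elim: k => [|k IHk]; first by rewrite big_ord0.
rewrite big_ord_recr /=; case: (x k).
  by rewrite mul1n leq_addl addnK mul1n addn_gt0 IHk orbT.
by rewrite mul0n addn0 addn_gt0 IHk.
Qed.

Lemma subsets0 u k : 0 < subsets u k 0.
Proof.
have := subsets_sum u k (fun _ => false).
by rewrite big1 // => i _; rewrite mul0n.
Qed.

Lemma wp_table n W u st :
  st.1 vn = n -> st.1 vW = W -> (forall k, k < n -> st.2 aU k = u k) ->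
  wp table_prog (8 + W * 20 + n * (11 + W * 70))
    (fun st' => forall k v, k <= n -> v < W ->
       st'.2 aD (k * W + v) = subsets u k v) st.
Proof.
move=> hn hW hu; subst W; set W := st.1 vW.
apply: (@wp_weaken _ (4 + W * 20 + (4 + n * (11 + W * 70)))) => [||]; [|lia|by move=> ? h; exact: h].
apply: wp_seq; apply: wp_weaken; first apply: wp_frame.
- apply: (@wp_for _ _ _ 13 _ (fun i st' => forall v, v < i ->
    st'.2 aD v = subsets u 0 v)) => //.
  move=> i st' hi fr IH; split=> //= v hv; rewrite /upd /=.
  by case: eqP => [->|vi]; [case: i {hi IH hv} => // i; rewrite subSS sub0n | apply: IH; lia].
- by rewrite /= -/W.
rewrite /= -/W => st0 [row0 [frv0 fra0]].
have n0 : st0.1 vn = n by rewrite (frv0 vn isT).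
have W0 : st0.1 vW = W by rewrite (frv0 vW isT).
apply: wp_weaken.
- apply: (@wp_for _ _ _ (4 + W * 70) _ (fun i st' => forall k v, k <= i -> v < W ->
    st'.2 aD (k * W + v) = subsets u k v)).
    by move=> k v; rewrite leqn0 => /eqP -> vW; rewrite row0.
  rewrite /= n0 => i st1 hi [frv1 fra1] IH.
  have W1 : (setv st1 vk i).1 vW = W by rewrite /= /upd /= (frv1 vW isT).
  apply: wp_weaken.
  + apply: (@wp_for _ _ _ 63 _ (fun j st' =>
      (forall k v, k <= i -> v < W -> st'.2 aD (k * W + v) = subsets u k v) /\
      (forall v, v < j -> st'.2 aD (i.+1 * W + v) = subsets u i.+1 v))).
      by split.
    rewrite [eval _ _]W1 => j st2 hj [frv2 fra2] [IH1 IH2]; split=> //=.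
    rewrite /upd /= (frv2 vk isT) (frv2 vW isT) W1 /= upd_eq (fra2 aU isT) /= (fra1 aU isT).
    rewrite (fra0 aU isT) hu // addn1.
    (* Row [i.+1] begins past every cell of the earlier rows, so writing it spoils no established
       entry. *)
    have ne k v : k <= i -> v < W -> k * W + v <> i.+1 * W + j.
      move=> hk hv e; have := leq_mul hk (leqnn W); rewrite mulSn in e; lia.
    split=> [k v hk hv|v hv].
      by move/eqP/negbTE: (ne k v hk hv) => ->; apply: IH1.
    case: eqP => [e|e]; last by apply: IH2; lia.
    have -> : v = j by lia.
    rewrite /= !IH1 //; last by lia.
    by congr (_ + _ * _); case: leqP; lia.
  + by rewrite [eval _ _]W1 /=; lia.
  rewrite [eval _ _]W1 => st2 [H1 H2] k v; rewrite leq_eqVlt => /predU1P [->|hk] hv.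
    exact: H2.
  exact: H1.
- by rewrite /= n0; lia.
- by rewrite /= n0.
Qed.

Lemma wp_best n W T u st :
  st.1 vn = n -> st.1 vW = W -> st.1 vT = T ->
  (forall v, v <= T %/ 2 -> st.2 aD (n * W + v) = subsets u n v) ->
  wp best_prog (13 + (T %/ 2).+1 * 50)
    (fun st' => [/\ st'.1 vbest <= T %/ 2, 0 < subsets u n (st'.1 vbest) &
       forall v, v <= T %/ 2 -> 0 < subsets u n v -> v <= st'.1 vbest]) st.
Proof.
move=> hn hW hT hD; subst W T; set h := _ %/ 2 in hD *.
apply: (@wp_weaken _ (3 + (8 + h.+1 * 50))) => [||]; [|lia|by move=> ? hh; exact: hh].
apply: wp_seq; apply: wp_asg; set st0 := setv _ _ _.
have eh : eval ($vT / #2 + #1)%prog st0 = h.+1 by rewrite /= addn1.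
apply: wp_weaken.
(* The bound [i.-1] admits the initial value 0, attained by the empty subset before any entry is
   examined. *)
- apply: (@wp_for _ _ _ 43 _ (fun i st' =>
    [/\ st'.1 vbest <= i.-1, 0 < subsets u n (st'.1 vbest) &
       forall v, v < i -> 0 < subsets u n v -> v <= st'.1 vbest])).
    by rewrite /= upd_eq; split=> //; apply: subsets0.
  rewrite eh => i st' hi [frv fra] [I1 I2 I3]; split=> //=.
  rewrite upd_eq /upd /= (fra aD isT) (frv vn isT) (frv vW isT) /st0 /= /upd /= hn hD //.
  case: (posnP (subsets u n i)) => c0.
    rewrite c0 subn0 muln1 subnn muln0 addn0; split=> //; first by lia.
    by move=> v; rewrite ltnS leq_eqVlt => /predU1P [->|]; [rewrite c0 | apply: I3].
  have -> : 1 - subsets u n i = 0 by lia.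
  by rewrite muln0 subn0 muln1 add0n; split=> //; lia.
- by rewrite eh /=; lia.
- by rewrite eh.
Qed.

(** The remainder stays attainable by the weights not yet treated; when none is left, attainability
    forces it to be 0, so the chosen weights sum to [b]. *)
Lemma wp_vertex n W b u st :
  st.1 vn = n -> st.1 vW = W -> st.1 vbest = b -> (forall k, k < n -> st.2 aU k = u k) ->
  (forall k v, k <= n -> v <= b -> st.2 aD (k * W + v) = subsets u k v) ->
  0 < subsets u n b ->
  wp vertex_prog (8 + n * 60)
    (fun st' => (forall k, k < n -> st'.2 aX k <= 1) /\
       \sum_(k < n) st'.2 aX k * u k = b) st.
Proof.
move=> hn hW eb hu hD hb; subst W b; set b := st.1 vbest.
apply: (@wp_weaken _ (4 + (4 + n * 60))) => [||]; [|lia|by move=> ? hh; exact: hh].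
apply: wp_seq; apply: wp_asg; set st0 := setv _ _ _.
have n0 : st0.1 vn = n by [].
apply: wp_weaken.
- apply: (@wp_for _ _ _ 53 _ (fun i st' =>
    [/\ forall k, n - i <= k < n -> st'.2 aX k <= 1,
       0 < subsets u (n - i) (st'.1 vrest) &
       \sum_(n - i <= k < n) st'.2 aX k * u k + st'.1 vrest = b])).
    rewrite subn0 big_geq // /st0 /= upd_eq; split=> // k; lia.
  rewrite [eval _ _]n0 => i st' hi [frv fra] [I1 I2 I3]; split=> //=.
  rewrite !upd_eq /upd /= (fra aD isT) (fra aU isT) (frv vn isT) (frv vW isT).
  rewrite /st0 /= /upd /= hn hu; last by lia.
  have -> : n - 1 - i = n - i.+1 by lia.
  set k := n - i.+1; have ek : n - i = k.+1 by lia.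
  rewrite ek in I1 I2 I3.
  have wb : st'.1 vrest <= b by lia.
  rewrite hD //; last by lia.
  rewrite (@big_ltn _ _ _ k) ?eqxx; last by lia.
  have -> : \sum_(k.+1 <= j < n) (if j == k then 1 - subsets u k (st'.1 vrest) else st'.2 aX j) * u j =
    \sum_(k.+1 <= j < n) st'.2 aX j * u j.
    by rewrite !big_nat; apply: eq_bigr => j hj; case: eqP => // e; lia.
  split.
  + move=> j hj; case: eqP => [_|e]; first exact: leq_subr.
    by apply: I1; lia.
  + case: (posnP (subsets u k (st'.1 vrest))) => c0.
      move: I2; rewrite /= c0 add0n subn0 mul1n.
      by case: (u k <= _); rewrite ?mul1n.
    by have -> : 1 - subsets u k (st'.1 vrest) = 0; [lia | rewrite mul0n subn0].
  + rewrite -I3; set s := \sum_(_ <= _ < _) _.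
    case: (posnP (subsets u k (st'.1 vrest))) => c0.
      move: I2; rewrite /= c0 add0n subn0 mul1n.
      by case: leqP => //; lia.
    by have -> : 1 - subsets u k (st'.1 vrest) = 0; lia.
- by rewrite [eval _ _]n0 /=; lia.
- move=> st'; rewrite [eval _ _]n0 subnn big_mkord => -[I1 I2 <-]; split.
    by move=> k hk; apply: I1.
  by move: I2; rewrite /=; case: eqP => // ->; rewrite addn0.
Qed.


Lemma wp_copy n st : st.1 vn = n ->
  wp copy_prog 100
    (fun st' => (forall k, k < n -> st'.2 aX k = st.2 aX k) /\
       (forall j, j < 4 -> j < n -> st'.2 aX (n + j) = st.2 aX j)) st.
Proof.
move=> hn; apply: wp_weaken.
- apply: (@wp_for _ _ _ 17 _ (fun i st' =>
    (forall k, k < n -> st'.2 aX k = st.2 aX k) /\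
    (forall j, j < i -> j < n -> st'.2 aX (n + j) = st.2 aX j))) => //.
  move=> i st' hi [frv fra] [I1 I2]; split=> //=.
  rewrite /upd /= (frv vn isT) hn; split=> [k hk|j hj jn].
    by case: eqP => [|_]; [lia | apply: I1].
  case: eqP => [/addnI e|e]; last by apply: I2 => //; lia.
  by subst j; apply: I1.
- by [].
- by [].
Qed.

Definition gap (a b : nat) : nat := (a - b) + (b - a).

Lemma wp_test st :
  let E := gap (2 * st.1 vSX) (st.1 vSS) in
  wp test_prog 60 (fun st' => st'.1 vflag =
    (E * E * st.1 vUU <= 16 * st.1 vn * (st.1 vUU * st.1 vQ - st.1 vC * st.1 vC))) st.
Proof.
split=> //=; rewrite /upd /= -/(gap _ _).
by case: leqP; lia.
Qed.

Lemma wp_main c n s st : st.1 vn = n -> (forall k, k < n -> st.2 aS k = s k) ->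
  let N := n ^ c in
  let Q := \sum_(k < n) s k * s k in
  let u k := rounded N Q (s k) in
  let T := \sum_(k < n) u k in
  wp (main_prog c)
    (6 + c * 20 + (7 + n * 27 + (4 + n * (29 + N * 60) + (7 + n * 19 + (6 +
     (8 + T.+1 * 20 + n * (11 + T.+1 * 70) + (13 + (T %/ 2).+1 * 50 +
     (8 + n * 60 + (7 + n * 27 + (7 + n * 19 + (7 + n * 27 + (7 + n * 27 +
     (60 + 100)))))))))))))
    (fun st' => exists x : nat -> nat,
      [/\ st'.1 vn = n, forall k, k < n -> x k <= 1 /\ st'.2 aX k = x k,
         forall j, j < 4 -> j < n -> st'.2 aX (n + j) = x j,
         forall y : nat -> bool,
           gap (2 * \sum_(k < n) x k * u k) T <= gap (2 * \sum_(k < n) y k * u k) T &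
         st'.1 vflag =
           (let E := gap (2 * \sum_(k < n) s k * x k) (\sum_(k < n) s k) in
            let UU := \sum_(k < n) u k * u k in
            let C := \sum_(k < n) u k * s k in
            E * E * UU <= 16 * n * (UU * Q - C * C))]) st.
Proof.
move=> hn hs N Q u T.
apply: wp_then; first exact: wp_power.
move=> st1 N1 [frv1 fra1].
have n1 : st1.1 vn = n by rewrite (frv1 vn isT).
have s1 k : k < n -> st1.2 aS k = s k by move=> hk; rewrite (fra1 aS isT) hs.
apply: wp_then.
  apply: (@wp_sum _ _ (fun k => s k * s k)) => //.
  by move=> i st' hi [frv fra]; rewrite /= /upd /= (fra aS isT) s1.
rewrite -/Q => st2 Q2 [frv2 fra2].
have n2 : st2.1 vn = n by rewrite (frv2 vn isT).
have s2 k : k < n -> st2.2 aS k = s k by move=> hk; rewrite (fra2 aS isT) s1.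
have N2 : st2.1 vN = N by rewrite (frv2 vN isT) N1 hn.
apply: wp_then; first exact: (wp_round _ _ _ _ _ n2 N2 Q2 s2).
move=> st3 u3 [frv3 fra3].
have n3 : st3.1 vn = n by rewrite (frv3 vn isT).
apply: wp_then.
  apply: (@wp_sum _ _ u) => //.
  by move=> i st' hi [frv fra]; rewrite /= /upd /= (fra aU isT) u3.
rewrite -/T => st4 T4 [frv4 fra4].
apply: wp_then.
  by apply: (wp_asg _ _ (fun st' => st'.1 vW = T.+1)); rewrite /= upd_eq T4 addn1.
move=> st5 W5 [frv5 fra5].
have n5 : st5.1 vn = n by rewrite (frv5 vn isT) (frv4 vn isT).
have u5 k : k < n -> st5.2 aU k = u k by move=> hk; rewrite (fra5 aU isT) (fra4 aU isT) u3.
apply: wp_then; first exact: (wp_table _ _ _ _ n5 W5 u5).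
move=> st6 D6 [frv6 fra6].
have n6 : st6.1 vn = n by rewrite (frv6 vn isT).
have W6 : st6.1 vW = T.+1 by rewrite (frv6 vW isT).
have T6 : st6.1 vT = T by rewrite (frv6 vT isT) (frv5 vT isT).
have hT : T %/ 2 <= T by apply: leq_div.
apply: wp_then.
  apply: (wp_best _ _ _ u _ n6 W6 T6) => v hv; apply: D6 => //; rewrite ltnS; exact: leq_trans hv hT.
move=> st7 [b7 c7 m7] [frv7 fra7].
have n7 : st7.1 vn = n by rewrite (frv7 vn isT).
have u7 k : k < n -> st7.2 aU k = u k.
  by move=> hk; rewrite (fra7 aU isT) (fra6 aU isT) u5.
apply: wp_then.
  apply: (wp_vertex _ T.+1 _ _ _ n7 _ erefl u7 _ c7); first by rewrite (frv7 vW isT).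
  by move=> k v hk hv; rewrite (fra7 aD isT) D6 //; apply: leq_ltn_trans hv _; lia.
move=> st8 [x8 b8] [frv8 fra8].
pose x := st8.2 aX.
have n8 : st8.1 vn = n by rewrite (frv8 vn isT).
have s8 k : k < n -> st8.2 aS k = s k.
  move=> hk; rewrite (fra8 aS isT) (fra7 aS isT) (fra6 aS isT) (fra5 aS isT).
  by rewrite (fra4 aS isT) (fra3 aS isT) s2.
have u8 k : k < n -> st8.2 aU k = u k by move=> hk; rewrite (fra8 aU isT) u7.
apply: wp_then.
  apply: (wp_sum _ _ (fun k => s k * x k) _ _ _ _ n8) => //.
  by move=> i st' hi [frv fra]; rewrite /= /upd /= (fra aS isT) (fra aX isT) s8.
move=> st9 A9 [frv9 fra9].
have n9 : st9.1 vn = n by rewrite (frv9 vn isT).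
apply: wp_then.
  apply: (wp_sum _ _ s _ _ _ _ n9) => //.
  by move=> i st' hi [frv fra]; rewrite /= /upd /= (fra aS isT) (fra9 aS isT) s8.
move=> st10 B10 [frv10 fra10].
have n10 : st10.1 vn = n by rewrite (frv10 vn isT).
apply: wp_then.
  apply: (wp_sum _ _ (fun k => u k * s k) _ _ _ _ n10) => //.
  move=> i st' hi [frv fra]; rewrite /= /upd /= (fra aS isT) (fra aU isT).
  by rewrite (fra10 aS isT) (fra10 aU isT) (fra9 aS isT) (fra9 aU isT) s8 // u8.
move=> st11 C11 [frv11 fra11].
have n11 : st11.1 vn = n by rewrite (frv11 vn isT).
apply: wp_then.
  apply: (wp_sum _ _ (fun k => u k * u k) _ _ _ _ n11) => //.
  move=> i st' hi [frv fra]; rewrite /= /upd /= (fra aU isT).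
  by rewrite (fra11 aU isT) (fra10 aU isT) (fra9 aU isT) u8.
move=> st12 U12 [frv12 fra12].
have n12 : st12.1 vn = n by rewrite (frv12 vn isT).
apply: wp_then; first exact: wp_test.
move=> st13 F13 [frv13 fra13].
have n13 : st13.1 vn = n by rewrite (frv13 vn isT).
have x13 k : st13.2 aX k = x k.
  by rewrite (fra13 aX isT) (fra12 aX isT) (fra11 aX isT) (fra10 aX isT) (fra9 aX isT).
apply: wp_weaken; first exact: (wp_frame _ _ _ _ (wp_copy _ _ n13)).
  by [].
move=> st14 [[X14 Y14] [frv14 fra14]]; exists x; split.
- by rewrite (frv14 vn isT).
- by move=> k hk; rewrite X14 // x13; split=> //; apply: x8.
- by move=> j hj jn; rewrite Y14 // x13.
- have best (y : nat -> bool) : 2 * \sum_(k < n) y k * u k <= T ->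
    \sum_(k < n) y k * u k <= st7.1 vbest.
    by move=> hy; apply: m7; [lia | apply: subsets_sum].
  move=> y; rewrite b8.
  have [hy|hy] := leqP (2 * \sum_(k < n) y k * u k) T.
    by have := best _ hy; rewrite /gap; lia.
  (* A sum beyond T / 2 is replaced by that of the complementary vertex, which has the same gap. *)
  have e : \sum_(k < n) ~~ y k * u k + \sum_(k < n) y k * u k = T.
    by rewrite -big_split /=; apply: eq_bigr => k _; case: (y k); rewrite /= ?mul0n ?mul1n ?addn0.
  have : 2 * \sum_(k < n) ~~ y k * u k <= T by lia.
  by move/(best (fun k => ~~ y k)); rewrite /gap; lia.
- rewrite (frv14 vflag isT) F13 n12 U12.
  have -> : st12.1 vQ = Q.
    rewrite (frv12 vQ isT) (frv11 vQ isT) (frv10 vQ isT) (frv9 vQ isT) (frv8 vQ isT).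
    by rewrite (frv7 vQ isT) (frv6 vQ isT) (frv5 vQ isT) (frv4 vQ isT) (frv3 vQ isT).
  rewrite (frv12 vC isT) C11 (frv12 vSS isT) (frv11 vSS isT) B10.
  by rewrite (frv12 vSX isT) (frv11 vSX isT) (frv10 vSX isT) A9.
Qed.

(** The table dominates with its n T entries, and n T <= N n^2; all other terms are absorbed because
    [n] and [N] are positive. *)
Lemma budget c n N T : 0 < n -> 0 < N -> T <= n * N ->
  6 + c * 20 + (7 + n * 27 + (4 + n * (29 + N * 60) + (7 + n * 19 + (6 +
    (8 + T.+1 * 20 + n * (11 + T.+1 * 70) + (13 + (T %/ 2).+1 * 50 +
    (8 + n * 60 + (7 + n * 27 + (7 + n * 19 + (7 + n * 27 + (7 + n * 27 +
    (60 + 100)))))))))))) <= (1000 + 20 * c) * (N * n ^ 2).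
Proof.
move=> n0 N0 hT.
have e : N * n ^ 2 = n * (n * N) by rewrite -mulnn mulnC -mulnA.
have h2 : 0 < n * N by rewrite muln_gt0 n0.
have h1 : n * N <= N * n ^ 2 by rewrite e leq_pmull.
have h3 : n <= n * N by rewrite leq_pmulr.
have h4 : n * T <= N * n ^ 2 by rewrite e leq_mul2l hT orbT.
have h5 : T %/ 2 <= T by apply: leq_div.
have h6 : c <= c * (N * n ^ 2) by rewrite leq_pmulr //; lia.
rewrite e in h1 h4 h6 *; move: (T %/ 2) h5 => T2 h5; lia.
Qed.

(** * Access to the input and output registers *)

Lemma foldl_act_cons rg i s : foldl act rg (i :: s) = foldl act (act rg i) s.
Proof. by []. Qed.

Ltac simpl_upd := repeat first
  [rewrite upd_eq
  |match goal with |- context [upd ?r ?d ?v ?i] =>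
     rewrite (upd_neq r d v i); [|by lia] end].
Ltac exec_one := rewrite foldl_act_cons actE; simpl_upd.

(** Register 0 is the only pointer available. Seven doublings take it to 128 n, beyond the input and
    all cells 56 + 8 i with i <= n; it ends at 128 n + 3, from which division by 128 recovers
    [n]. *)
Definition save_regs : seq instr :=
  [:: IStore 0 1; IConst 1 1; IAdd 0 0 1; IStore 0 2; IAdd 0 0 1; IStore 0 3;
      IAdd 0 0 1; IStore 0 4; IConst 1 128; IDiv 0 0 1; IConst 1 0; IAdd 1 1 0;
      IConst 3 4; ISub 4 1 3].

(* Moves input register [i] to [cell 0 i.-1], that is, [56 + 8 i]. *)
Definition move_input : seq instr :=
  [:: IConst 2 8; IMul 2 2 1; IConst 3 56; IAdd 2 2 3; ILoad 3 1; IStore 2 3;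
      IConst 3 1; ISub 1 1 3; IConst 3 4; ISub 4 1 3].

Definition restore_regs : seq instr :=
  [:: IConst 1 128; IMul 1 1 0; IConst 4 1;
      ILoad 2 1; IConst 3 64; IStore 3 2; IAdd 1 1 4;
      ILoad 2 1; IConst 3 72; IStore 3 2; IAdd 1 1 4;
      ILoad 2 1; IConst 3 80; IStore 3 2; IAdd 1 1 4;
      ILoad 2 1; IConst 3 88; IStore 3 2].

(* The input occupies every low register but 0, so registers 1 to 4 are first
   parked at [128 n] to get scratch space; the remaining inputs are then moved
   to array 0 in decreasing order, which never overwrites one not yet moved. *)
Definition prologue : scmd :=
  Then (Do (nseq 7 (IAdd 0 0 0) ++ save_regs))
    (Then (While 4 (Do move_input)) (Do restore_regs)).

Definition parked (n : nat) (rg rg' : regs) : Prop :=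
  [/\ rg' (128 * n) = rg 1, rg' (128 * n + 1) = rg 2,
      rg' (128 * n + 1 + 1) = rg 3 & rg' (128 * n + 1 + 1 + 1) = rg 4].

Definition input_moved (n : nat) (rg : regs) (i : nat) (rg' : regs) : Prop :=
  [/\ [/\ rg' 0 = n, rg' 1 = i & rg' 4 = i - 4], i <= n, parked n rg rg',
      forall k, 4 < k <= i -> rg' k = rg k &
      forall k, i <= k < n -> rg' (cell 0 k) = rg k.+1].

Lemma save_regsP n rg : 0 < n -> rg 0 = 128 * n ->
  input_moved n rg n (foldl act rg save_regs).
Proof.
move=> n0 r0; rewrite /save_regs.
rewrite foldl_act_cons actE r0.
do 2! exec_one; rewrite r0; do 7! exec_one.
have -> : (128 * n + 1 + 1 + 1) %/ 128 = n by lia.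
do 4! exec_one; rewrite [foldl _ _ [::]]/=; split.
- by split; simpl_upd.
- by [].
- by split; simpl_upd.
- by move=> k hk; simpl_upd.
- by move=> k; lia.
Qed.

Lemma move_inputP n rg i rg' : 4 < i -> input_moved n rg i rg' ->
  input_moved n rg i.-1 (foldl act rg' move_input).
Proof.
move=> i4 [[r0 r1 r4] iN [p1 p2 p3 p4] lo hi]; rewrite /move_input.
exec_one; exec_one; rewrite r1; exec_one; exec_one; exec_one; rewrite r1.
have -> : rg' i = rg i by apply: lo; lia.
do 5! exec_one; rewrite r1 [foldl _ _ [::]]/=; split.
- by split; simpl_upd => //; lia.
- by lia.
- by split; simpl_upd.
- by move=> k hk; simpl_upd; apply: lo; lia.
- move=> k hk; rewrite /cell.
  have [e|ne] : k = i.-1 \/ i <= k by lia.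
    have -> : 64 + 8 * k + 0 = 8 * i + 56 by lia.
    by simpl_upd; congr rg; lia.
  by simpl_upd; rewrite -hi /cell //; lia.
Qed.

Lemma restore_regsP n rg i rg' : 0 < n -> i <= 4 -> input_moved n rg i rg' ->
  let rg2 := foldl act rg' restore_regs in
  rg2 0 = n /\ forall k, k < n -> rg2 (cell 0 k) = rg k.+1.
Proof.
move=> n0 i4 [[r0 r1 r4] iN [p1 p2 p3 p4] lo hi].
suff : (fun rg2 : regs => rg2 0 = n /\ forall k, k < n -> rg2 (cell 0 k) = rg k.+1)
  (foldl act rg' restore_regs) by [].
rewrite /restore_regs.
exec_one; exec_one; rewrite r0; exec_one; exec_one; rewrite p1.
do 4! exec_one; rewrite p2; do 4! exec_one; rewrite p3; do 4! exec_one; rewrite p4.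
do 2! exec_one; rewrite [foldl _ _ [::]]/=; split; first by simpl_upd.
move=> k hk; rewrite /cell.
have [->|[->|[->|[->|k4]]]] : k = 0 \/ k = 1 \/ k = 2 \/ k = 3 \/ 3 < k by lia.
- by simpl_upd.
- by simpl_upd.
- by simpl_upd.
- by simpl_upd.
by simpl_upd; rewrite -hi /cell //; lia.
Qed.

Lemma prologueP n (rg : regs) : 0 < n -> rg 0 = n ->
  exists t rg', [/\ t <= 60 + n * 12, runs prologue rg t rg',
    rg' 0 = n & forall k, k < n -> rg' (cell 0 k) = rg k.+1].
Proof.
move=> n0 r0.
set rg0 := foldl act rg (nseq 7 (IAdd 0 0 0)).
have rg00 : rg0 0 = 128 * n.
  rewrite /rg0; do 7! (rewrite foldl_act_cons actE); rewrite [foldl _ _ [::]]/=.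
  rewrite !upd_eq r0; lia.
have := save_regsP _ _ n0 rg00; set rg1 := foldl act rg0 _ => H1.
pose Inv m rg' := exists i, m = i - 4 /\ input_moved n rg0 i rg'.
have [|m rg' [i [em hI]]||t [rg2 [ht [hw [i [ei hI]]]]]] :=
  @runs_while 4 (Do move_input) 10 Inv _ _ (n - 4) rg1 _.
- by move=> rg' [i [em [[_ _ ->]]]].
- case: (hI) => -[_ _ ->] _ _ _ _; split; first by lia.
  exists 10, (foldl act rg' move_input); split=> //; split; first exact: (runs_do move_input).
  by exists i.-1; split; [lia | apply: move_inputP => //; lia].
- by exists n.
have [|r2 c2] := restore_regsP _ _ _ _ n0 _ hI; first by lia.
exists (21 + (t + 18)), (foldl act rg2 restore_regs); split=> //.
- by lia.
- apply: runs_then; last by apply: runs_then hw _; exact: (runs_do restore_regs).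
  have := runs_do (nseq 7 (IAdd 0 0 0) ++ save_regs) rg isT.
  by rewrite foldl_cat.
Qed.

(* [67 + 8 j] is [cell 3 j]. *)
Definition move_output : seq instr :=
  [:: IConst 2 8; IMul 2 2 1; IConst 3 67; IAdd 2 2 3; ILoad 2 2;
      IConst 3 1; IAdd 1 1 3; IStore 1 2; ISub 4 0 1].

(** Registers 4 down to 1 are filled in this order so that the next lower one is still scratch;
    register 0 gives up [n] only for the last address. The offsets 91, 83, 75, 67 are [cell 3 3] to
    [cell 3 0]. *)
Definition last_outputs : seq instr :=
  [:: IConst 4 8; IMul 4 4 0; IConst 3 91; IAdd 4 4 3; ILoad 4 4;
      IConst 3 8; IMul 3 3 0; IConst 2 83; IAdd 3 3 2; ILoad 3 3;
      IConst 2 8; IMul 2 2 0; IConst 1 75; IAdd 2 2 1; ILoad 2 2;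
      IConst 1 8; IMul 1 1 0; IConst 0 67; IAdd 1 1 0; ILoad 1 1; IConst 0 1].

(* Moving array 3 down to the output registers in increasing order never
   overwrites an entry not yet moved; the first four entries are read from the
   copy at indices [n .. n+3], which lies above every output register. *)
Definition epilogue : scmd :=
  Then (Do [:: IMul 0 0 vflag])
    (If vflag (Then (Do [:: IConst 1 4; ISub 4 0 1])
       (Then (While 4 (Do move_output)) (Do last_outputs)))).

Definition output_moved (n : nat) (x : nat -> nat) (k : nat) (rg : regs) : Prop :=
  [/\ [/\ rg 0 = n, rg 1 = k & rg 4 = n - k], 4 <= k,
      forall j, 4 <= j < k -> j < n -> rg j.+1 = x j,
      forall j, k <= j < n -> rg (cell 3 j) = x j &
      forall j, j < 4 -> j < n -> rg (cell 3 (n + j)) = x j].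

Lemma move_outputP n x k rg : k < n -> output_moved n x k rg ->
  output_moved n x k.+1 (foldl act rg move_output).
Proof.
move=> kn [[r0 r1 r4] k4 lo hi cp]; rewrite /move_output.
exec_one; exec_one; rewrite r1; do 3! exec_one.
have -> : rg (8 * k + 67) = x k.
  by rewrite -(hi k) ?leqnn //; congr rg; rewrite /cell; lia.
exec_one; exec_one; rewrite r1; exec_one; exec_one; rewrite r0 [foldl _ _ [::]]/=; split.
- by split; simpl_upd; lia.
- by lia.
- move=> j hj jn.
  have [->|jk] : j = k \/ 4 <= j < k by lia.
    by rewrite -[k.+1]addn1; simpl_upd.
  by simpl_upd; apply: lo.
- by move=> j hj; rewrite /cell; simpl_upd; apply: hi; lia.
- by move=> j hj jn; rewrite /cell; simpl_upd; apply: cp.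
Qed.

Lemma last_outputsP n x k rg : n <= k -> output_moved n x k rg ->
  let rg' := foldl act rg last_outputs in
  rg' 0 = 1 /\ forall j, j < n -> rg' j.+1 = x j.
Proof.
move=> nk [[r0 r1 r4] k4 lo hi cp].
suff : (fun rg' : regs => rg' 0 = 1 /\ forall j, j < n -> rg' j.+1 = x j)
  (foldl act rg last_outputs) by [].
rewrite /last_outputs.
exec_one; exec_one; rewrite r0; do 3! exec_one.
exec_one; exec_one; rewrite r0; do 3! exec_one.
exec_one; exec_one; rewrite r0; do 3! exec_one.
exec_one; exec_one; rewrite r0; do 4! exec_one.
rewrite [foldl _ _ [::]]/=; split; first by simpl_upd.
have cpE j a : j < 4 -> j < n -> a = 64 + 8 * (n + j) + 3 -> rg a = x j.
  by move=> j4 jn ->; apply: cp.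
move=> j jn; have [e|[e|[e|[e|j4]]]] : j = 0 \/ j = 1 \/ j = 2 \/ j = 3 \/ 3 < j by lia.
- by subst j; simpl_upd; apply: cpE => //; lia.
- by subst j; simpl_upd; apply: cpE => //; lia.
- by subst j; simpl_upd; apply: cpE => //; lia.
- by subst j; simpl_upd; apply: cpE => //; lia.
by simpl_upd; apply: lo => //; lia.
Qed.

Lemma epilogueP n x (b : bool) (rg : regs) : rg 0 = n -> rg vflag = b ->
  (forall k, k < n -> rg (cell 3 k) = x k) ->
  (forall j, j < 4 -> j < n -> rg (cell 3 (n + j)) = x j) ->
  exists t rg', [/\ t <= 30 + n * 11, runs epilogue rg t rg', rg' 0 = b &
    b -> forall k, k < n -> rg' k.+1 = x k].
Proof.
move=> r0 rb hx cp.
(* The product is already the answer 0 if the flag is 0, and still [n] if it is 1. *)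
set rg1 := act rg (IMul 0 0 vflag).
have b1 : rg1 vflag = b by rewrite /rg1 actE; simpl_upd; exact: rb.
have r01 : rg1 0 = n * b by rewrite /rg1 actE upd_eq r0 rb.
have start : runs (Do [:: IMul 0 0 vflag]) rg 1 rg1.
  exact: (runs_do [:: IMul 0 0 vflag]).
case: b rb b1 r01 => /= rb b1 r01; last first.
  exists 2, rg1; split=> //.
  - by apply: (runs_then _ _ _ _ _ _ _ start); apply: runs_if_false.
  - by rewrite r01 muln0.
set rg2 := foldl act rg1 [:: IConst 1 4; ISub 4 0 1].
have out2 : output_moved n x 4 rg2.
  rewrite /rg2; exec_one; exec_one; rewrite r01 muln1 [foldl _ _ [::]]/=; split.
  - by split; simpl_upd => //; rewrite r01 muln1.
  - by [].
  - by move=> j; lia.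
  - by move=> j hj; rewrite /cell; simpl_upd; rewrite /rg1 actE; simpl_upd; apply: hx; lia.
  - by move=> j hj jn; rewrite /cell; simpl_upd; rewrite /rg1 actE; simpl_upd; apply: cp.
pose Inv m rg' := exists k, m = n - k /\ output_moved n x k rg'.
have [|m rg' [k [em hI]]||t [rg3 [ht [hw [k [ek hI]]]]]] :=
  @runs_while 4 (Do move_output) 9 Inv _ _ (n - 4) rg2 _.
- by move=> rg' [k [em [[_ _ ->]]]].
- case: (hI) => -[_ _ ->] _ _ _ _; split; first by lia.
  exists 9, (foldl act rg' move_output); split=> //; split; first exact: (runs_do move_output).
  by exists k.+1; split; [lia | apply: move_outputP => //; lia].
- by exists 4.
have [|r3 o3] := last_outputsP n x k _ _ hI; first by lia.
exists (1 + (2 + (t + 21)).+1), (foldl act rg3 last_outputs); split=> //.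
- by lia.
- apply: (runs_then _ _ _ _ _ _ _ start); apply: runs_if_true; first by rewrite b1.
  apply: runs_then; first exact: (runs_do [:: IConst 1 4; ISub 4 0 1]).
  by apply: runs_then hw _; exact: (runs_do last_outputs).
Qed.

(** Everything here is about natural numbers; real geometry enters only afterwards. The 1200 is the
    1000 of the main program plus room for the input and output phases. *)
Lemma machineP c n (rg : regs) : 0 < n -> rg 0 = n ->
  let s k := rg k.+1 in
  let N := n ^ c in
  let Q := \sum_(k < n) s k * s k in
  let u k := rounded N Q (s k) in
  let T := \sum_(k < n) u k in
  let P := assemble 0 (Then prologue (Then (ccmd 32 (main_prog c)) epilogue)) in
  exists t (x : nat -> nat), let cf := run P t (0, rg) in
  [/\ t <= (1200 + 20 * c) * (N * n ^ 2), halted P cf, forall k, k < n -> x k <= 1,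
    forall y : nat -> bool,
      gap (2 * \sum_(k < n) x k * u k) T <= gap (2 * \sum_(k < n) y k * u k) T &
    let b := let E := gap (2 * \sum_(k < n) s k * x k) (\sum_(k < n) s k) in
             let UU := \sum_(k < n) u k * u k in
             let C := \sum_(k < n) u k * s k in
             E * E * UU <= 16 * n * (UU * Q - C * C) in
    cf.2 0 = b /\ (b -> forall k, k < n -> cf.2 k.+1 = x k)].
Proof.
move=> n0 r0 s N Q u T P.
have [t1 [rg1 [t1b run1 r01 s1]]] := prologueP n rg n0 r0.
pose st : store := (rg1, fun a j => rg1 (cell a j)).
have [costb [x [n2 x2 y2 opt2 b2]]] := wp_main c n s st r01 s1.
have sim : simulates rg1 st by [].
have [t2 [rg2 [t2b run2 sim2 _]]] := ccmdP _ 32 _ _ (leqnn _) (cwf_main c) sim.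
have [t3 [rg3 [t3b run3 r03 x3]]] := epilogueP n x _ rg2
  (etrans (sim2.1 0 isT) n2) (etrans (sim2.1 vflag isT) b2)
  (fun k hk => etrans (sim2.2 3 k isT) (x2 k hk).2)
  (fun j hj jn => etrans (sim2.2 3 (n + j) isT) (y2 j hj jn)).
have all := run_assemble _ _ _ _ (runs_then _ _ _ _ _ _ _ run1
  (runs_then _ _ _ _ _ _ _ run2 run3)).
exists (t1 + (t2 + t3)), x; rewrite all; split.
- have N0 : 0 < N by rewrite expn_gt0 n0.
  have TN : T <= n * N.
    rewrite -[n in n * N]card_ord -sum_nat_const leq_sum // => i _; exact: rounded_le.
  have := leq_trans t2b (leq_trans costb (budget c n N T n0 N0 TN)).
  have h1 : n <= N * n ^ 2 by rewrite -mulnn mulnA leq_pmull // muln_gt0 N0.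
  by rewrite !mulnDl; move: (N * n ^ 2) h1 => M h1; lia.
- exact: halted_end.
- by move=> k /x2 [].
- by [].
- by [].
Qed.

(** * Geometry of the two slabs *)

Local Open Scope ring_scope.

Definition dot (F : realFieldType) (n : nat) (a b : 'I_n -> F) : F := \sum_(i < n) a i * b i.

Lemma dotC (F : realFieldType) (n : nat) (a b : 'I_n -> F) : dot F n a b = dot F n b a.
Proof. by apply: eq_bigr => i _; rewrite mulrC. Qed.

Lemma dot_comb (F : realFieldType) (n : nat) (a b y : 'I_n -> F) (k l : F) :
  dot F n (fun i => k * b i - l * a i) y = k * dot F n b y - l * dot F n a y.
Proof.
by rewrite /dot !mulr_sumr -sumrB; apply: eq_bigr => i _; rewrite mulrBl !mulrA.
Qed.

Lemma dot_ge0 (F : realFieldType) (n : nat) (a : 'I_n -> F) : 0 <= dot F n a a.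
Proof. by apply: sumr_ge0 => i _; rewrite -expr2 sqr_ge0. Qed.

Lemma dot_gt0 (F : realFieldType) (n : nat) (a : 'I_n -> F) k :
  a k != 0 -> 0 < dot F n a a.
Proof.
move=> ak; rewrite /dot (bigD1 k) //= ltr_wpDr //.
  by apply: sumr_ge0 => i _; rewrite -expr2 sqr_ge0.
by rewrite -expr2 exprn_even_gt0.
Qed.

Lemma cauchy_schwarz (F : realFieldType) (n : nat) (a b : 'I_n -> F) :
  dot F n a b ^+ 2 <= dot F n a a * dot F n b b.
Proof.
have [A0|A0] := eqVneq (dot F n a a) 0.
  have a0 i : a i = 0.
    apply/eqP; apply: contraT => /(dot_gt0 F n a i).
    by rewrite A0 ltxx.
  by rewrite A0 mul0r /dot big1 ?expr0n // => i _; rewrite a0 mul0r.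
have Ap : 0 < dot F n a a by rewrite lt_def A0 dot_ge0.
set A := dot F n a a in A0 Ap *; set C := dot F n a b; set B := dot F n b b.
have := dot_ge0 F n (fun i => A * b i - C * a i).
rewrite dot_comb ![dot F n _ (fun i => A * b i - C * a i)]dotC !dot_comb.
rewrite -/B -/A -/C (dotC _ _ b a) -/C => h.
have : 0 <= A * (A * B - C ^+ 2) by move: h; congr (_ <= _); ring.
by rewrite pmulr_rge0 // subr_ge0.
Qed.

(* The component of [A b - C a] along [y] measures the angle between [a] and
   [b]: its squared length is [A (A B - C^2)]. *)
Lemma dot_tilt (F : realFieldType) (n : nat) (a b y : 'I_n -> F) (t : F) :
  0 < dot F n a a ->
  let D := dot F n a a * dot F n b b - dot F n a b ^+ 2 in
  let Y := dot F n y y in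
  dot F n a y ^+ 2 * dot F n b b <= t * (Y * D) ->
  dot F n b y ^+ 2 * dot F n a a <= 2 * (1 + t) * (Y * D).
Proof.
move=> A0 D Y hp.
have CS := cauchy_schwarz F n (fun i => dot F n a a * b i - dot F n a b * a i) y.
rewrite !dot_comb ![dot F n _ (fun i => _ * b i - _ * a i)]dotC !dot_comb in CS.
have C2 := cauchy_schwarz F n a b.
rewrite (dotC _ _ b a) in CS.
move: hp CS C2 A0; rewrite /D -/Y.
move: (dot F n a a) (dot F n b b) (dot F n a b) (dot F n a y) (dot F n b y) => A B C p q.
move=> hp CS C2 A0.
(* Origin of 2 (1 + t): splitting A q into (A q - C p) + C p costs a factor 2, the tilt contributes
   1 and the hypothesis on [a] contributes t. *)
have h1 : (A * q) ^+ 2 <= 2 * (A * q - C * p) ^+ 2 + 2 * (C ^+ 2 * p ^+ 2).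
  rewrite -subr_ge0.
  have -> : 2 * (A * q - C * p) ^+ 2 + 2 * (C ^+ 2 * p ^+ 2) - (A * q) ^+ 2 =
    (A * q - 2 * C * p) ^+ 2 by ring.
  exact: sqr_ge0.
have h2 : C ^+ 2 * p ^+ 2 <= A * (t * (Y * (A * B - C ^+ 2))).
  apply: le_trans (ler_wpM2l (ltW A0) hp).
  have -> : A * (p ^+ 2 * B) = A * B * p ^+ 2 by ring.
  by apply: ler_wpM2r => //; apply: sqr_ge0.
rewrite -(ler_pM2l A0); apply: le_trans (_ : (A * q) ^+ 2 <= _).
  by rewrite le_eqVlt; apply/orP; left; apply/eqP; ring.
apply: le_trans h1 _; move: CS h2 => CS h2.
have -> : A * (2 * (1 + t) * (Y * (A * B - C ^+ 2))) =
  2 * (A * (A * B - C * C) * Y) + 2 * (A * (t * (Y * (A * B - C ^+ 2)))) by ring.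
apply: lerD; rewrite ler_pM2l //.
by apply: le_trans CS _; rewrite le_eqVlt; apply/orP; left; apply/eqP; ring.
Qed.

(** Squaring and multiplying by |S|^2 |U|^2 clears roots and quotients; the half-width is t d*, with
    t = 1 for the thin slab and t = 4 for the thick one. *)
Lemma in_slab_dstar (n c : nat) (s : 'I_n -> nat) (x : 'I_n -> R) (t : nat) :
  let a := Svec s in let b := Uvec c s in
  let y i := x i - half_ones i in
  0 < dot R n a a -> 0 < dot R n b b ->
  (- (2 * t%:R * dstar c s / 2) <= dot R n a y / vnorm a <= 2 * t%:R * dstar c s / 2) =
  (dot R n a y ^+ 2 * dot R n b b <=
     t%:R ^+ 2 * (n%:R / 4 * (dot R n a a * dot R n b b - dot R n a b ^+ 2))).
Proof.
move=> a b y A0 B0.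
have C2 := cauchy_schwarz R n a b.
have vn2 (v : 'I_n -> R) : vnorm v = Num.sqrt (dot R n v v).
  by congr Num.sqrt; apply: eq_bigr => i _; rewrite expr2.
have ca : c_a c s ^+ 2 = dot R n a b ^+ 2 / (dot R n a a * dot R n b b).
  rewrite /c_a -/a -/b !vn2 expr_div_n exprMn !sqr_sqrtr ?dot_ge0 //.
  by rewrite -[\sum_(k < n) _]/(dot R n b a) dotC [dot R n b b * _]mulrC.
have ca1 : 0 <= 1 - c_a c s ^+ 2.
  by rewrite ca subr_ge0 ler_pdivrMr ?mulr_gt0 // mul1r.
have -> : 2 * t%:R * dstar c s / 2 = t%:R * dstar c s by field.
have d0 : 0 <= t%:R * dstar c s.
  by rewrite mulr_ge0 // /dstar !mulr_ge0 ?sqrtr_ge0 // invr_ge0.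
rewrite -ler_norml -(ler_pXn2r (_ : 0 < 2)%N) ?nnegrE //.
rewrite real_normK ?num_real // expr_div_n vn2 sqr_sqrtr ?dot_ge0 //.
rewrite exprMn /dstar exprMn expr_div_n !sqr_sqrtr // ?ler0n // ca.
move: (dot R n a a) (dot R n b b) (dot R n a b) (dot R n a y) A0 B0 => A B C p A0 B0.
rewrite -(ler_pM2r (mulr_gt0 A0 B0)).
have A1 : A != 0 by rewrite gt_eqF.
have B1 : B != 0 by rewrite gt_eqF.
by congr (_ <= _); field; rewrite A1 ?B1.
Qed.

(** * Real quantities in terms of the computed integers *)

Lemma sum_lt_ord m N : (m <= N)%N -> (\sum_(j < N) (j < m) = m)%N.
Proof.
move=> mN; have {2}<- : minn m N = m by lia.
elim: N {mN} => [|N IHN]; first by rewrite big_ord0 minn0.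
by rewrite big_ord_recr /= IHN; case: ltnP; lia.
Qed.

(** The positive integers below z are exactly 1 to floor z, so counting them gives the floor;
    stopping at [N] loses none because s^2 <= Q gives z <= N. *)
Lemma floor_rounded N Q s : (0 < Q)%N -> (s * s <= Q)%N ->
  Num.floor (N%:R * (s%:R / Num.sqrt Q%:R) : R) = (rounded N Q s)%:Z.
Proof.
move=> Q0 sQ; set z : R := _ * _.
have Qp : 0 < Q%:R :> R by rewrite ltr0n.
have z0 : 0 <= z by rewrite !mulr_ge0 ?ler0n // invr_ge0 sqrtr_ge0.
have z2 : z ^+ 2 = (N * N * (s * s))%:R / Q%:R.
  by rewrite exprMn expr_div_n sqr_sqrtr ?ler0n // !natrM; field; rewrite gt_eqF.
have le_z j : (j%:R <= z) = (j * j * Q <= N * N * (s * s))%N.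
  rewrite -(ler_pXn2r (_ : 0 < 2)%N) ?nnegrE ?ler0n // z2 ler_pdivlMr //.
  by rewrite -natrX -natrM ler_nat.
have f0 : 0 <= Num.floor z by rewrite floor_ge0.
have [m em] : exists m : nat, Num.floor z = m%:Z by exists `|Num.floor z|%N; rewrite gez0_abs.
have le_m (j : nat) : (j <= m)%N = (j%:R <= z).
  by have := floor_ge_int z j%:Z; rewrite em lez_nat.
have mN : (m <= N)%N.
  have zN : z <= N%:R.
    rewrite -(ler_pXn2r (_ : 0 < 2)%N) ?nnegrE ?ler0n // z2 ler_pdivrMr //.
    by rewrite -natrX -natrM ler_nat -mulnn leq_mul.
  by rewrite -(ler_nat R); apply: le_trans zN; rewrite -le_m.
rewrite em /rounded; congr Posz; rewrite -[LHS](sum_lt_ord m N mN).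
by apply: eq_bigr => j _; rewrite -le_z -le_m.
Qed.

Lemma natr_gap a b : (gap a b)%:R = `|a%:R - b%:R| :> R.
Proof.
rewrite /gap; have [ab|/ltnW ba] := leqP a b.
  by rewrite (eqP ab) add0n natrB // distrC ger0_norm // subr_ge0 ler_nat.
by rewrite (eqP ba) addn0 natrB // ger0_norm // subr_ge0 ler_nat.
Qed.

Lemma dot_natr n (f g : nat -> nat) (a b : 'I_n -> R) :
  (forall k : 'I_n, a k = (f k)%:R) -> (forall k : 'I_n, b k = (g k)%:R) ->
  dot R n a b = (\sum_(k < n) f k * g k)%:R.
Proof.
by move=> ha hb; rewrite natr_sum; apply: eq_bigr => k _; rewrite ha hb natrM.
Qed.

Lemma dot_centred n (f g : nat -> nat) (a x : 'I_n -> R) :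
  (forall k : 'I_n, a k = (f k)%:R) -> (forall k : 'I_n, x k = (g k)%:R) ->
  2 * dot R n a (fun i => x i - half_ones i) =
  (2 * \sum_(k < n) f k * g k)%:R - (\sum_(k < n) f k)%:R.
Proof.
move=> ha hx; rewrite natrM !natr_sum !mulr_sumr -sumrB; apply: eq_bigr => k _.
by rewrite ha hx natrM /half_ones; field.
Qed.

Lemma dot_half n (g : nat -> nat) (x : 'I_n -> R) :
  (forall k : 'I_n, (g k <= 1)%N) -> (forall k : 'I_n, x k = (g k)%:R) ->
  dot R n (fun i => x i - half_ones i) (fun i => x i - half_ones i) = n%:R / 4.
Proof.
move=> g1 hx; rewrite /dot (eq_bigr (fun _ => 1 / 4)).
  by rewrite sumr_const card_ord -mulr_natl; field.
by move=> k _; rewrite hx /half_ones; case: (g k) (g1 k) => [|[|//]] _; field.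
Qed.

Lemma input_regsS n (s : 'I_n -> nat) (k : 'I_n) : input_regs s k.+1 = s k.
Proof. by rewrite /input_regs /= insubT //= => h; congr s; apply: val_inj. Qed.

(** * From the machine's output to the two alternatives *)

Theorem theorem2p4 (c : nat) :
  exists (P : program) (K : nat),
  forall (m n : nat) (s : 'I_n -> nat),
    (forall k, (s k <= 2 ^ m)%N) ->
    (exists k, s k != 0%N) ->
    (exists k, Uvec c s k != 0) ->
    exists t : nat,
      (t%:R <= K%:R * (Nval n c)%:R * (n%:R ^+ 2 * Num.sqrt (n%:R)) :> R) /\
      halted P (run P t (0%N, input_regs s)) /\
      output_correct c s (run P t (0%N, input_regs s)).2.
Proof.
have ten_le : 2 * (1 + 2 * (1 + 1)) <= 4%:R ^+ 2 :> R by lra.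
eexists; exists (1200 + 20 * c)%N => m n s _ [ks sk0] [ku uk0].
have n0 : (0 < n)%N by apply: leq_ltn_trans (ltn_ord ks).
have [t [x [tb halt x1 opt [flag out]]]] := machineP c n (input_regs s) n0 erefl.
exists t; split; last (split; first exact: halt).
  apply: le_trans (_ : ((1200 + 20 * c) * (Nval n c * n ^ 2))%:R <= _).
    by rewrite ler_nat.
  rewrite natrM [(Nval n c * _)%:R]natrM natrX -mulrA; do 2! apply: ler_wpM2l => //.
  rewrite ler_peMr ?sqr_ge0 // -[X in X <= _]sqrtr1 ler_sqrt ?ltr0n //.
  by rewrite ler1n.
move: flag out; set rg := (run _ _ _).2 => flag out; cbv zeta in flag, out.
set f := fun k => input_regs s k.+1 in opt flag.
set Q := (\sum_(k < n) f k * f k)%N in opt flag.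
set u := fun k => rounded (n ^ c) Q (f k).
have sE (k : 'I_n) : Svec s k = (f k)%:R by rewrite /f input_regsS.
have A_E : dot R n (Svec s) (Svec s) = Q%:R by apply: dot_natr.
have A0 : 0 < dot R n (Svec s) (Svec s) by apply: (dot_gt0 _ _ _ ks); rewrite pnatr_eq0.
have Q0 : (0 < Q)%N by move: A0; rewrite A_E ltr0n.
have uE (k : 'I_n) : Uvec c s k = (u k)%:R.
  rewrite /Uvec.
  have -> : vnorm (Svec s) = Num.sqrt Q%:R.
    by rewrite -A_E; congr Num.sqrt; apply: eq_bigr => i _; rewrite expr2.
  rewrite sE floor_rounded // /Q (bigD1 k) //=; exact: leq_addr.
have B0 : 0 < dot R n (Uvec c s) (Uvec c s) by apply: (dot_gt0 _ _ _ ku).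
have D0 : 0 <= dot R n (Svec s) (Svec s) * dot R n (Uvec c s) (Uvec c s) -
    dot R n (Svec s) (Uvec c s) ^+ 2.
  by rewrite subr_ge0 cauchy_schwarz.
have C_E : dot R n (Svec s) (Uvec c s) = (\sum_(k < n) u k * f k)%:R.
  by rewrite dotC; apply: dot_natr.
have B_E : dot R n (Uvec c s) (Uvec c s) = (\sum_(k < n) u k * u k)%:R by apply: dot_natr.
pose xR (k : 'I_n) : R := (x k)%:R.
have xRE (k : 'I_n) : xR k = (x k)%:R by [].
pose centred (z : 'I_n -> R) i := z i - half_ones i.
set b := (_ <= _)%N in flag out.
(* The integer test is this inequality multiplied by 4, since its gap is 2 |S.y|. *)
have bE : b = (dot R n (Svec s) (centred xR) ^+ 2 * dot R n (Uvec c s) (Uvec c s) <=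
  4%:R ^+ 2 * (n%:R / 4 * (dot R n (Svec s) (Svec s) * dot R n (Uvec c s) (Uvec c s)
     - dot R n (Svec s) (Uvec c s) ^+ 2))).
  rewrite /b -(ler_nat R) !natrM natr_gap -(dot_centred _ _ _ _ _ sE xRE).
  (* Cauchy-Schwarz makes the truncated subtraction |U|^2 |S|^2 - (U.S)^2 exact. *)
  rewrite natrB; last first.
    by rewrite -(ler_nat R) !natrM -A_E -/u -B_E -C_E -subr_ge0 -expr2 mulrC.
  rewrite !natrM -/u -A_E -B_E -C_E -expr2 real_normK ?num_real //.
  rewrite -/(centred xR).
  rewrite -[RHS](ler_pM2l (_ : 0 < 4 :> R)) ?ltr0n //.
  by congr (_ <= _); field.
have tilt_x (y : 'I_n -> R) : is_vertex y ->
    dot R n (Svec s) (centred y) ^+ 2 * dot R n (Uvec c s) (Uvec c s) <=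
    1%:R ^+ 2 * (n%:R / 4 * (dot R n (Svec s) (Svec s) * dot R n (Uvec c s) (Uvec c s)
     - dot R n (Svec s) (Uvec c s) ^+ 2)) -> b.
  move=> vy; rewrite expr1n => thin.
  (* Optimality is stated for boolean functions on all naturals, so the vertex is extended by
     false. *)
  pose g k : bool := if insub k is Some i then y i == 1 else false.
  have yE (k : 'I_n) : y k = (g k)%:R.
    rewrite /g valK; case: (vy k) => ->; last by rewrite eqxx.
    by rewrite eq_sym oner_eq0.
  have Yy := dot_half n g y (fun k => leq_b1 _) yE.
  have Yx := dot_half n x xR (fun k => x1 _ (ltn_ord k)) xRE.
  (* The tilt is applied from S to U at the hypothetical vertex [y], then from U to S at the
     computed vertex [x]. *)
  have step1 := dot_tilt _ _ (Svec s) (Uvec c s) (centred y) 1 A0.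
  have step2 := dot_tilt _ _ (Uvec c s) (Svec s) (centred xR) (2 * (1 + 1)) B0.
  rewrite /= Yy in step1.
  rewrite /= Yx (dotC _ _ (Uvec c s) (Svec s)) in step2.
  rewrite [dot _ n (Uvec c s) (Uvec c s) * dot _ n (Svec s) _]mulrC in step2.
  have closer : dot R n (Uvec c s) (centred xR) ^+ 2 <= dot R n (Uvec c s) (centred y) ^+ 2.
    rewrite -(ler_pM2l (_ : 0 < 2 ^+ 2 :> R)) ?exprn_gt0 // -!exprMn.
    have ex : 2 * dot R n (Uvec c s) (centred xR) = _ := dot_centred _ _ _ _ _ uE xRE.
    have ey : 2 * dot R n (Uvec c s) (centred y) = _ := dot_centred _ _ (fun k => g k) _ _ uE yE.
    rewrite ex ey.
    rewrite -[leLHS]real_normK ?num_real // -[leRHS]real_normK ?num_real //.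
    rewrite -!natr_gap ler_pXn2r ?nnegrE ?ler0n // ler_nat.
    under eq_bigr do rewrite mulnC.
    under [X in (_ <= gap (2 * X) _)%N]eq_bigr do rewrite mulnC.
    exact: opt.
  have {}step1 : dot R n (Uvec c s) (centred xR) ^+ 2 * dot R n (Svec s) (Svec s) <= 
      2 * (1 + 1) * (n%:R / 4 * (dot R n (Svec s) (Svec s) * dot R n (Uvec c s) (Uvec c s)
     - dot R n (Svec s) (Uvec c s) ^+ 2)).
    by apply: le_trans (step1 _); [rewrite ler_pM2r | rewrite mul1r in thin *].
  rewrite bE; apply: le_trans (step2 _) _; first exact: step1.
  by apply: ler_wpM2r ten_le; rewrite mulr_ge0 // divr_ge0.
have [b1|b0] := boolP b; [right | left]; rewrite flag ?b1 ?(negbTE b0); split=> //.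
  split.
    by move=> k; rewrite /output_vertex out //; case: (x k) (x1 _ (ltn_ord k)) => [|[|//]] _; [left|right].
  split.
    by move=> k; rewrite /output_vertex out // ler0n lern1; exact: x1.
  have -> : 8 * dstar c s = 2 * 4%:R * dstar c s by ring.
  rewrite (_ : \sum_(i < n) _ = dot R n (Svec s) (centred xR)).
    by rewrite in_slab_dstar // -bE.
  by apply: eq_bigr => i _; rewrite /output_vertex out.
case=> y [vy [_]].
rewrite -[\sum_(i < n) _]/(dot R n (Svec s) (centred y)).
have -> : 2 * dstar c s = 2 * 1%:R * dstar c s by rewrite mulr1.
rewrite in_slab_dstar // => /(tilt_x y vy).
by rewrite (negbTE b0).
Qed.
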